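(* Let $k$ be an infinite perfect field, let $\mathcal{A}$ and $\mathcal{B}$ be small additive categories, and let $\pi:\mathcal{A}\to\mathcal{B}$ be a full, additive and essentially surjective functor, with $k$-trivial codomain $\mathcal{B}$. Let $F$, $F'$ and $G$ be three functors from $\mathcal{B}$ to $k\text{-}\mathbf{Mod}$, with $F$ contravariant and $F',G$ covariant. Let $\pi^*F$ denote the composition $F\circ\pi$ (and similarly for $F'$, $G$). Restriction along $\pi$ yields isomorphisms $$\mathrm{Ext}^*_{k[\mathcal{A}]}(\pi^*F',\pi^*G)\simeq \mathrm{Ext}^*_{k[\mathcal{B}]}(F',G),$$ $$\mathrm{Tor}_*^{k[\mathcal{A}]}(\pi^*F,\pi^*G)\simeq \mathrm{Tor}_*^{k[\mathcal{B}]}(F,G).$$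
   Context: ''Small'' means that isomorphism classes of objects form a set. An additive category $\mathcal{B}$ is $k$-trivial if for all objects $x,y$ the abelian group $\mathcal{B}(x,y)$ is finite and $k\otimes_{\mathbb{Z}}\mathcal{B}(x,y)=0$ (equivalently, $k$ being a field, its cardinality is invertible in $k$). For a small category $\mathcal{C}$, $k[\mathcal{C}]\text{-}\mathbf{Mod}$ is the category of all (not necessarily additive) functors $\mathcal{C}\to k\text{-}\mathbf{Mod}$, and $\mathrm{Ext}^*_{k[\mathcal{C}]}$ is computed there. For $F:\mathcal{C}^{\mathrm{op}}\to k\text{-}\mathbf{Mod}$ and $G:\mathcal{C}\to k\text{-}\mathbf{Mod}$, $F\otimes_{k[\mathcal{C}]}G=\int^{x}F(x)\otimes_k G(x)$ and $\mathrm{Tor}_*^{k[\mathcal{C}]}$ is its left derived functor. Restriction along $\pi$ induces $\pi^*:\mathrm{Ext}^*_{k[\mathcal{B}]}(F',G)\to\mathrm{Ext}^*_{k[\mathcal{A}]}(\pi^*F',\pi^*G)$ and $\mathrm{res}^\pi:\mathrm{Tor}_*^{k[\mathcal{A}]}(\pi^*F,\pi^*G)\to\mathrm{Tor}_*^{k[\mathcal{B}]}(F,G)$, the latter derived from the map sending the class of $s\otimes s'\in F(\pi(x))\otimes G(\pi(x))$ to its class in $F\otimes_{k[\mathcal{B}]}G$. *)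

(* Defs.v *)
(* MathComp, with the classical axioms of mathcomp.classical.boolp. *)
From HB Require Import structures.
From mathcomp Require Import all_boot all_order all_algebra all_field.
From mathcomp Require Import finmap.
From mathcomp.multinomials Require Import monalg.
From mathcomp Require Import boolp classical_sets cardinality.

Set Implicit Arguments.
Unset Strict Implicit.
Unset Printing Implicit Defensive.

Import GRing.Theory.
Local Open Scope ring_scope.
Local Open Scope quotient_scope.

Lemma linear_ext (R : nzRingType) (U V : lmodType R) (f g : {linear U -> V}) :
  f =1 g -> f = g.
Proof.
case: f g => [f cf] [g cg] /= /funext fg; subst g; congr (GRing.Linear.Pack _).
case: cf cg => [[a] [b]] [[a'] [b']].
by rewrite (Prop_irrelevance a a') (Prop_irrelevance b b').
Qed.

Section SubModule.
Variables (R : nzRingType) (V : lmodType R) (Z : submodClosed V).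

Record sub_of := SubOf { sub_val : V; sub_valP : sub_val \in Z }.
HB.instance Definition _ := [isSub for sub_val].
HB.instance Definition _ := [Choice of sub_of by <:].
HB.instance Definition _ := [SubChoice_isSubLmodule of sub_of by <:].

End SubModule.

Section Quotient.
Variables (R : nzRingType) (V : lmodType R) (S : submodClosed V).

Let zS : {pred V} := [pred v | v \in S].
Fact quot_zmod_closed : zmod_closed zS.
Proof.
split=> [|u v]; rewrite !inE ?rpred0 // => uS vS.
by rewrite -scaleN1r rpredD ?rpredZ.
Qed.
HB.instance Definition _ := GRing.isZmodClosed.Build V zS quot_zmod_closed.
Local Notation Q := (Quotient.quot zS).

Definition quot_of : Type := Q.
HB.instance Definition _ := GRing.Zmodule.on quot_of.
Definition quot_pi (v : V) : quot_of := \pi_Q v.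

Lemma quot_eqP (u v : V) : quot_pi u = quot_pi v <-> u - v \in S.
Proof.
have e : (quot_pi u == quot_pi v) = (u - v \in S) by rewrite eqmodE.
by rewrite -e; split => /eqP.
Qed.

Lemma quot_repr (u : V) : repr (quot_pi u : Q) - u \in S.
Proof. by apply/quot_eqP; rewrite /quot_pi reprK. Qed.

Lemma quot_piP (q : quot_of) : quot_pi (repr (q : Q)) = q.
Proof. exact: reprK. Qed.

Lemma quot_piD : {morph quot_pi : u v / u + v}.
Proof. by move=> u v; rewrite /quot_pi raddfD. Qed.

Definition quot_scale (a : R) (q : quot_of) : quot_of :=
  quot_pi (a *: repr (q : Q)).

Lemma quot_scaleE a v : quot_scale a (quot_pi v) = quot_pi (a *: v).
Proof. by apply/quot_eqP; rewrite -scalerBr rpredZ ?quot_repr. Qed.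

Fact quot_scaleA a b q : quot_scale a (quot_scale b q) = quot_scale (a * b) q.
Proof. by rewrite -(quot_piP q) !quot_scaleE scalerA. Qed.
Fact quot_scale1 : left_id 1 quot_scale.
Proof. by move=> q; rewrite -(quot_piP q) !quot_scaleE scale1r. Qed.
Fact quot_scaleDr : right_distributive quot_scale +%R.
Proof.
move=> a p q; rewrite -(quot_piP p) -(quot_piP q) -quot_piD !quot_scaleE.
by rewrite -quot_piD scalerDr.
Qed.
Fact quot_scaleDl q : {morph quot_scale^~ q : a b / a + b}.
Proof.
by move=> a b; rewrite -(quot_piP q) !quot_scaleE -quot_piD scalerDl.
Qed.
HB.instance Definition _ := GRing.Zmodule_isLmodule.Build R quot_of
  quot_scaleA quot_scale1 quot_scaleDr quot_scaleDl.

Fact quot_pi_linear : linear quot_pi.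
Proof. by move=> a u v; rewrite quot_piD -quot_scaleE. Qed.
HB.instance Definition _ :=
  GRing.isLinear.Build R V quot_of _ quot_pi quot_pi_linear.

Section Lift.
Variables (W : lmodType R) (f : {linear V -> W}).
Hypothesis fS : forall v, v \in S -> f v = 0.

Definition quot_lift_fun (q : quot_of) : W := f (repr (q : Q)).

Lemma quot_lift_funE v : quot_lift_fun (quot_pi v) = f v.
Proof.
by apply/eqP; rewrite -subr_eq0 -linearB /= fS // quot_repr.
Qed.

Fact quot_lift_linear : linear quot_lift_fun.
Proof.
move=> a p q; rewrite -(quot_piP p) -(quot_piP q) -linearP.
by rewrite !quot_lift_funE linearP.
Qed.
HB.instance Definition _ :=
  GRing.isLinear.Build R quot_of W _ quot_lift_fun quot_lift_linear.

Definition quot_lift : {linear quot_of -> W} := quot_lift_fun.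

Lemma quot_liftE v : quot_lift (quot_pi v) = f v.
Proof. exact: quot_lift_funE. Qed.

End Lift.
End Quotient.

Section Submodules.
Variable R : nzRingType.

Definition zero_sub (V : lmodType R) : {pred V} := [pred v | v == 0].
Fact zero_sub_closed (V : lmodType R) : submod_closed (@zero_sub V).
Proof.
by split=> [|a u v /eqP-> /eqP->]; rewrite !inE ?scaler0 ?addr0.
Qed.
HB.instance Definition _ (V : lmodType R) :=
  GRing.isSubmodClosed.Build R V (@zero_sub V) (@zero_sub_closed V).

Definition full_sub (V : lmodType R) : {pred V} := [pred v | true].
Fact full_sub_closed (V : lmodType R) : submod_closed (@full_sub V).
Proof. by []. Qed.
HB.instance Definition _ (V : lmodType R) :=
  GRing.isSubmodClosed.Build R V (@full_sub V) (@full_sub_closed V).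

Definition ker_sub (V W : lmodType R) (f : {linear V -> W}) : {pred V} :=
  [pred v | f v == 0].
Fact ker_sub_closed (V W : lmodType R) (f : {linear V -> W}) :
  submod_closed (ker_sub f).
Proof.
split=> [|a u v]; rewrite !inE ?linear0 //.
by move=> /eqP fu /eqP fv; rewrite linearP fu fv scaler0 addr0.
Qed.
HB.instance Definition _ (V W : lmodType R) (f : {linear V -> W}) :=
  GRing.isSubmodClosed.Build R V (ker_sub f) (ker_sub_closed f).

Definition im_sub (V W : lmodType R) (f : {linear V -> W}) : {pred W} :=
  [pred w | `[< exists v, f v = w >]].
Fact im_sub_closed (V W : lmodType R) (f : {linear V -> W}) :
  submod_closed (im_sub f).
Proof.
split=> [|a u v]; first by apply/asboolP; exists 0; rewrite linear0.
move=> /asboolP[u' <-] /asboolP[v' <-]; apply/asboolP; exists (a *: u' + v').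
by rewrite linearP.
Qed.
HB.instance Definition _ (V W : lmodType R) (f : {linear V -> W}) :=
  GRing.isSubmodClosed.Build R W (im_sub f) (im_sub_closed f).

Definition preim_sub (V W : lmodType R) (f : {linear V -> W})
  (S : submodClosed W) : {pred V} := [pred v | f v \in S].
Fact preim_sub_closed (V W : lmodType R) (f : {linear V -> W})
  (S : submodClosed W) : submod_closed (preim_sub f S).
Proof.
split=> [|a u v]; rewrite !inE ?linear0 ?rpred0 //.
by move=> fu fv; rewrite linearP rpredD ?rpredZ.
Qed.
HB.instance Definition _ (V W : lmodType R) (f : {linear V -> W})
    (S : submodClosed W) :=
  GRing.isSubmodClosed.Build R V (preim_sub f S) (preim_sub_closed f S).

Definition span_sub (V : lmodType R) (E : V -> Prop) : {pred V} :=
  [pred v | `[< forall S : submodClosed V, (forall e, E e -> e \in S) ->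
                v \in S >]].
Fact span_sub_closed (V : lmodType R) (E : V -> Prop) :
  submod_closed (span_sub E).
Proof.
split=> [|a u v]; first by apply/asboolP => S _; rewrite rpred0.
move=> /asboolP uS /asboolP vS; apply/asboolP => S ES.
by rewrite rpredD ?rpredZ ?uS ?vS.
Qed.
HB.instance Definition _ (V : lmodType R) (E : V -> Prop) :=
  GRing.isSubmodClosed.Build R V (span_sub E) (span_sub_closed E).

Lemma span_sub_in (V : lmodType R) (E : V -> Prop) e :
  E e -> e \in span_sub E.
Proof. by move=> Ee; apply/asboolP => S; apply. Qed.

Lemma span_sub_ker (V W : lmodType R) (E : V -> Prop) (f : {linear V -> W}) :
  (forall e, E e -> f e = 0) -> forall v, v \in span_sub E -> f v = 0.
Proof.
move=> fE v /asboolP /(_ (ker_sub f)) h.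
by apply/eqP/h => e /fE; rewrite inE => ->.
Qed.

(* The subquotient Z / (Z :&: B) of V. *)
Definition subquo (V : lmodType R) (Z B : submodClosed V) : lmodType R :=
  quot_of (preim_sub (val : {linear sub_of Z -> V}) B).

Section SubquoMap.
Variables (V V' : lmodType R) (Z B : submodClosed V) (Z' B' : submodClosed V').
Variable f : {linear V -> V'}.
Hypothesis fZ : forall v, v \in Z -> f v \in Z'.
Hypothesis fB : forall v, v \in B -> f v \in B'.

Definition sub_map (z : sub_of Z) : sub_of Z' := SubOf (fZ (sub_valP z)).
Fact sub_map_linear : linear sub_map.
Proof. by move=> a u v; apply: val_inj => /=; rewrite linearP. Qed.
HB.instance Definition _ :=
  GRing.isLinear.Build R (sub_of Z) (sub_of Z') _ sub_map sub_map_linear.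

Definition subquo_pi (z : sub_of Z) : subquo Z B := quot_pi _ z.

Fact subquo_map_subproof (z : sub_of Z) :
  z \in preim_sub (val : {linear sub_of Z -> V}) B ->
  (quot_pi (preim_sub (val : {linear sub_of Z' -> V'}) B') \o sub_map) z = 0.
Proof.
move=> zB /=; rewrite -(linear0 (quot_pi _)); apply/quot_eqP.
by rewrite subr0 inE /=; apply: fB.
Qed.

Definition subquo_map : {linear subquo Z B -> subquo Z' B'} :=
  quot_lift subquo_map_subproof.

End SubquoMap.
End Submodules.

Section Free.
Variables (R : nzRingType) (T : choiceType).

Section Lift.
Variables (V : lmodType R) (h : T -> V).

Definition free_lift_fun (g : {malg R[T]}) : V :=
  \sum_(t <- msupp g) g@_t *: h t.

Lemma free_lift_fun_sub (g : {malg R[T]}) (d : {fset T}) :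
  (msupp g `<=` d)%fset -> free_lift_fun g = \sum_(t <- d) g@_t *: h t.
Proof.
move=> gd; rewrite /free_lift_fun (big_fset_incl _ gd) //.
by move=> t _ /mcoeff_outdom ->; rewrite scale0r.
Qed.

Fact free_lift_linear : linear free_lift_fun.
Proof.
move=> a u v; pose d := (msupp u `|` msupp v)%fset.
have du : (msupp u `<=` d)%fset by apply: fsubsetUl.
have dv : (msupp v `<=` d)%fset by apply: fsubsetUr.
have duv : (msupp (a *: u + v) `<=` d)%fset.
  apply: fsubset_trans (msuppD_le _ _) _; rewrite fsubUset dv andbT.
  by apply: fsubset_trans (msuppZ_le _ _) du.
rewrite (free_lift_fun_sub du) (free_lift_fun_sub dv) (free_lift_fun_sub duv).
rewrite scaler_sumr -big_split /=; apply: eq_bigr => t _.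
by rewrite mcoeffD mcoeffZ scalerDl scalerA.
Qed.
HB.instance Definition _ :=
  GRing.isLinear.Build R {malg R[T]} V _ free_lift_fun free_lift_linear.

Definition free_lift : {linear {malg R[T]} -> V} := free_lift_fun.

Lemma free_liftE t : free_lift << t >> = h t.
Proof.
rewrite /free_lift /= (free_lift_fun_sub (msuppU_le)) big_seq_fset1.
by rewrite mcoeffUU scale1r.
Qed.

End Lift.

Lemma free_ext (V : lmodType R) (f g : {linear {malg R[T]} -> V}) :
  (forall t, f << t >> = g << t >>) -> f = g.
Proof.
move=> fg; apply: linear_ext => u; rewrite (monalgE u) !linear_sum /=.
apply: eq_bigr => t _.
have -> : << u@_t *g t >> = u@_t *: << t >> :> {malg R[T]}.
  by apply/malgP => s; rewrite mcoeffZ !mcoeffU mulrnAr mulr1.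
by rewrite !linearZ /= fg.
Qed.

End Free.

Record cat := Cat {
  obj :> Type;
  hom : obj -> obj -> Type;
  idc : forall x, hom x x;
  compc : forall x y z, hom y z -> hom x y -> hom x z;
  comp1c : forall x y (f : hom x y), compc (idc y) f = f;
  compc1 : forall x y (f : hom x y), compc f (idc x) = f;
  compcA : forall x y z t (h : hom z t) (g : hom y z) (f : hom x y),
    compc h (compc g f) = compc (compc h g) f }.
Arguments hom {c} x y.
Arguments idc {c} x.
Arguments compc {c x y z} g f.

Definition opcat (C : cat) : cat :=
  @Cat C (fun x y => hom y x) (fun x => idc x) (fun _ _ _ g f => compc f g)
    (fun _ _ f => compc1 f) (fun _ _ f => comp1c f)
    (fun _ _ _ _ h g f => esym (compcA f g h)).

Record functor (C D : cat) := Functor {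
  fobj :> C -> D;
  fmor : forall x y : C, hom x y -> hom (fobj x) (fobj y);
  fmor1 : forall x, fmor (idc x) = idc (fobj x);
  fmorM : forall x y z (g : hom y z) (f : hom x y),
    fmor (compc g f) = compc (fmor g) (fmor f) }.
Arguments fmor {C D} p {x y} f : rename.

Definition opfunctor (C D : cat) (p : functor C D) :
    functor (opcat C) (opcat D) :=
  @Functor (opcat C) (opcat D) p (fun _ _ f => fmor p f) (fmor1 p)
    (fun _ _ _ g f => fmorM p f g).

Definition full (C D : cat) (p : functor C D) : Prop :=
  forall (x y : C) (g : hom (p x) (p y)), exists f : hom x y, fmor p f = g.

Definition isomorphic (C : cat) (x y : C) : Prop :=
  exists (f : hom x y) (g : hom y x), compc g f = idc x /\ compc f g = idc y.

Definition essentially_surjective (C D : cat) (p : functor C D) : Prop :=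
  forall y : D, exists x : C, isomorphic (p x) y.

(* A small preadditive category with a zero object (both initial and terminal)
   and binary biproducts.  Smallness is the existence of the type [aobj]. *)
Record addcat := AddCat {
  aobj : Type;
  ahom : aobj -> aobj -> zmodType;
  aid : forall x, ahom x x;
  acomp : forall x y z, ahom y z -> ahom x y -> ahom x z;
  acomp1c : forall x y (f : ahom x y), acomp (aid y) f = f;
  acompc1 : forall x y (f : ahom x y), acomp f (aid x) = f;
  acompA : forall x y z t (h : ahom z t) (g : ahom y z) (f : ahom x y),
    acomp h (acomp g f) = acomp (acomp h g) f;
  acompDl : forall x y z (g g' : ahom y z) (f : ahom x y),
    acomp (g + g') f = acomp g f + acomp g' f;
  acompDr : forall x y z (g : ahom y z) (f f' : ahom x y),
    acomp g (f + f') = acomp g f + acomp g f';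
  azero : exists z, forall x,
    (forall f g : ahom z x, f = g) /\ (forall f g : ahom x z, f = g);
  abiprod : forall x y, exists s
    (i1 : ahom x s) (i2 : ahom y s) (p1 : ahom s x) (p2 : ahom s y),
    [/\ acomp p1 i1 = aid x, acomp p2 i2 = aid y,
        acomp p1 i2 = 0, acomp p2 i1 = 0
      & acomp i1 p1 + acomp i2 p2 = aid s] }.

Coercion cat_of_addcat (A : addcat) : cat :=
  @Cat (aobj A) (fun x y => ahom x y) (@aid A) (@acomp A)
    (@acomp1c A) (@acompc1 A) (@acompA A).

Definition additive_functor (A B : addcat) (p : functor A B) : Prop :=
  forall (x y : aobj A) (f g : ahom x y),
    fmor p (f + g) = fmor p f + fmor p g :> ahom (p x) (p y).

Section TensorZ.
Variables M N : zmodType.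

Inductive tensZ_rel : {malg int[(M * N)%type]} -> Prop :=
| TensZDl m m' n :
    tensZ_rel (<< (m + m', n) >> - << (m, n) >> - << (m', n) >>)
| TensZDr m n n' :
    tensZ_rel (<< (m, n + n') >> - << (m, n) >> - << (m, n') >>).

(* The abelian group M \otimes_Z N, by generators and relations. *)
Definition tensZ : zmodType := quot_of (span_sub tensZ_rel).

End TensorZ.

Definition k_trivial (k : fieldType) (B : addcat) : Prop :=
  forall x y : aobj B,
    finite_set [set: ahom x y] /\ (forall t : tensZ k (ahom x y), t = 0).

Definition perfect_field (k : fieldType) : Prop :=
  forall p : {poly k}, irreducible_poly p -> separable_poly p.

(* [kfunctor k C] is the type of objects of k[C]-Mod: functors from C to
   k-modules; contravariant ones are [kfunctor k (opcat C)]. *)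
Record kfunctor (k : fieldType) (C : cat) := KFunctor {
  kobj :> C -> lmodType k;
  kmap : forall x y : C, hom x y -> {linear kobj x -> kobj y};
  kmap1 : forall x (v : kobj x), kmap (idc x) v = v;
  kmapM : forall x y z (g : hom y z) (f : hom x y) (v : kobj x),
    kmap (compc g f) v = kmap g (kmap f v) }.
Arguments kmap {k C} F {x y} f : rename.

Definition pull (k : fieldType) (C D : cat) (p : functor C D)
    (F : kfunctor k D) : kfunctor k C.
Proof.
refine (@KFunctor k C (fun x => F (p x)) (fun x y f => kmap F (fmor p f)) _ _).
- by move=> x v; rewrite fmor1 kmap1.
- by move=> x y z g f v; rewrite fmorM kmapM.
Defined.

Section Nattrans.
Variables (k : fieldType) (C : cat).

Record nattrans (F G : kfunctor k C) := Nattrans {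
  app :> forall x, {linear F x -> G x};
  app_nat : forall x y (f : hom x y) (v : F x),
    app y (kmap F f v) = kmap G f (app x v) }.

Lemma nattrans_ext (F G : kfunctor k C) (u v : nattrans F G) :
  (forall x s, u x s = v x s) -> u = v.
Proof.
case: u v => [u nu] [v nv] /= uv.
have e : u = v.
  by apply/functional_extensionality_dep => x; apply: linear_ext => s; apply: uv.
by subst v; rewrite (Prop_irrelevance nu nv).
Qed.

Definition nat_id (F : kfunctor k C) : nattrans F F :=
  @Nattrans F F (fun x => idfun) (fun _ _ _ _ => erefl).

Definition nat_comp (F G H : kfunctor k C)
    (v : nattrans G H) (u : nattrans F G) : nattrans F H.
Proof.
refine (@Nattrans F H (fun x => v x \o u x : {linear F x -> H x}) _).
by move=> x y f s /=; rewrite !app_nat.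
Defined.

Section Module.
Variables F G : kfunctor k C.

HB.instance Definition _ := gen_eqMixin (nattrans F G).
HB.instance Definition _ := gen_choiceMixin (nattrans F G).

Definition nat_zero : nattrans F G.
Proof.
refine (@Nattrans F G (fun x => \0 : {linear F x -> G x}) _).
by move=> x y f s /=; rewrite linear0.
Defined.

Definition nat_add (u v : nattrans F G) : nattrans F G.
Proof.
refine (@Nattrans F G (fun x => u x \+ v x : {linear F x -> G x}) _).
by move=> x y f s /=; rewrite !app_nat linearD.
Defined.

Definition nat_opp (u : nattrans F G) : nattrans F G.
Proof.
refine (@Nattrans F G (fun x => \- u x : {linear F x -> G x}) _).
by move=> x y f s /=; rewrite !app_nat linearN.
Defined.

Definition nat_scale (a : k) (u : nattrans F G) : nattrans F G.
Proof.
refine (@Nattrans F G (fun x => a \*: u x : {linear F x -> G x}) _).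
by move=> x y f s /=; rewrite !app_nat linearZ.
Defined.

Fact nat_addA : associative nat_add.
Proof. by move=> u v w; apply: nattrans_ext => x s /=; rewrite addrA. Qed.
Fact nat_addC : commutative nat_add.
Proof. by move=> u v; apply: nattrans_ext => x s /=; rewrite addrC. Qed.
Fact nat_add0 : left_id nat_zero nat_add.
Proof. by move=> u; apply: nattrans_ext => x s /=; rewrite add0r. Qed.
Fact nat_addN : left_inverse nat_zero nat_opp nat_add.
Proof. by move=> u; apply: nattrans_ext => x s /=; rewrite addNr. Qed.
HB.instance Definition _ := GRing.isZmodule.Build (nattrans F G)
  nat_addA nat_addC nat_add0 nat_addN.

Fact nat_scaleA a b u : nat_scale a (nat_scale b u) = nat_scale (a * b) u.
Proof. by apply: nattrans_ext => x s /=; rewrite scalerA. Qed.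
Fact nat_scale1 : left_id 1 nat_scale.
Proof. by move=> u; apply: nattrans_ext => x s /=; rewrite scale1r. Qed.
Fact nat_scaleDr : right_distributive nat_scale +%R.
Proof. by move=> a u v; apply: nattrans_ext => x s /=; rewrite scalerDr. Qed.
Fact nat_scaleDl u : {morph nat_scale^~ u : a b / a + b}.
Proof. by move=> a b; apply: nattrans_ext => x s /=; rewrite scalerDl. Qed.
HB.instance Definition _ := GRing.Zmodule_isLmodule.Build k (nattrans F G)
  nat_scaleA nat_scale1 nat_scaleDr nat_scaleDl.

End Module.

Section Precomp.
Variables (F' F G : kfunctor k C) (u : nattrans F' F).

Definition precomp_fun (v : nattrans F G) : nattrans F' G := nat_comp v u.
Fact precomp_linear : linear precomp_fun.
Proof. by move=> a v w; apply: nattrans_ext. Qed.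
HB.instance Definition _ := GRing.isLinear.Build k (nattrans F G)
  (nattrans F' G) _ precomp_fun precomp_linear.
Definition precomp : {linear nattrans F G -> nattrans F' G} := precomp_fun.

End Precomp.
End Nattrans.

Section Pull.
Variables (k : fieldType) (C D : cat) (p : functor C D).

Definition pull_nat_fun (F G : kfunctor k D) (u : nattrans F G) :
  nattrans (pull p F) (pull p G) :=
  @Nattrans k C (pull p F) (pull p G) (fun x => u (p x))
    (fun _ _ f => app_nat u (fmor p f)).
Fact pull_nat_linear (F G : kfunctor k D) : linear (@pull_nat_fun F G).
Proof. by move=> a u v; apply: nattrans_ext. Qed.
HB.instance Definition _ (F G : kfunctor k D) :=
  GRing.isLinear.Build k (nattrans F G) (nattrans (pull p F) (pull p G)) _
    (@pull_nat_fun F G) (@pull_nat_linear F G).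
Definition pull_nat (F G : kfunctor k D) :
  {linear nattrans F G -> nattrans (pull p F) (pull p G)} :=
  @pull_nat_fun F G.

End Pull.
Arguments pull_nat {k C D} p {F G}.

Section Tensor.
Variables (k : fieldType) (C : cat).
Variables (F : kfunctor k (opcat C)) (G : kfunctor k C).

Definition tens_gen : choiceType := {classic {x : C & (F x * G x)%type}}.
Definition tgen (x : C) (s : F x) (t : G x) : tens_gen :=
  existT (fun x : C => (F x * G x)%type) x (s, t).

Inductive tens_rel : {malg k[tens_gen]} -> Prop :=
| TensDl (x : C) (s s' : F x) (t : G x) :
    tens_rel (<< tgen (s + s') t >> - << tgen s t >> - << tgen s' t >>)
| TensDr (x : C) (s : F x) (t t' : G x) :
    tens_rel (<< tgen s (t + t') >> - << tgen s t >> - << tgen s t' >>)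
| TensZl a (x : C) (s : F x) (t : G x) :
    tens_rel (<< tgen (a *: s) t >> - a *: << tgen s t >>)
| TensZr a (x : C) (s : F x) (t : G x) :
    tens_rel (<< tgen s (a *: t) >> - a *: << tgen s t >>)
| TensDinat (x y : C) (f : hom x y) (s : F y) (t : G x) :
    tens_rel (<< tgen (@kmap _ (opcat C) F y x f s) t >>
              - << tgen s (kmap G f t) >>).

(* The coend of F(x) \otimes_k G(x), presented by the symbols [tens_el s t]
   standing for the class of s \otimes t. *)
Definition tens : lmodType k := quot_of (span_sub tens_rel).
Definition tens_el (x : C) (s : F x) (t : G x) : tens :=
  quot_pi _ << tgen s t >>.

Lemma tens_ext (V : lmodType k) (f g : {linear tens -> V}) :
  (forall (x : C) (s : F x) (t : G x), f (tens_el s t) = g (tens_el s t)) -> f = g.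
Proof.
move=> fg; apply: linear_ext => q; rewrite -(quot_piP q).
move: (repr _) => u.
pose pi : {linear {malg k[tens_gen]} -> tens} := quot_pi (span_sub tens_rel).
suff e : f \o pi = g \o pi :> {linear _ -> _}.
  exact: (congr1 (fun h : {linear _ -> _} => h u) e).
by apply: free_ext => -[x [s t]]; apply: fg.
Qed.

Section Lift.
Variables (V : lmodType k) (h : forall x : C, F x -> G x -> V).
Hypothesis hl : forall (x : C) (t : G x), linear (fun s => h s t).
Hypothesis hr : forall (x : C) (s : F x), linear (h s).
Hypothesis hd : forall (x y : C) (f : hom x y) (s : F y) (t : G x),
  h (@kmap _ (opcat C) F y x f s) t = h s (kmap G f t).

Let h0 (g : tens_gen) : V := h (projT2 g).1 (projT2 g).2.

Fact tens_lift_subproof (u : {malg k[tens_gen]}) :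
  u \in span_sub tens_rel -> free_lift h0 u = 0.
Proof.
apply: span_sub_ker => e; case=> {e}.
- move=> x s s' t; rewrite !linearB !free_liftE /h0 /=.
  by have := hl t 1 s s'; rewrite !scale1r => ->; rewrite addrAC addrK subrr.
- move=> x s t t'; rewrite !linearB !free_liftE /h0 /=.
  by have := hr s 1 t t'; rewrite !scale1r => ->; rewrite addrAC addrK subrr.
- move=> a x s t; rewrite linearB linearZ !free_liftE /h0 /=.
  have h00 : h 0 t = 0.
    by have := hl t (-1) 0 0; rewrite scaler0 addr0 scaleN1r addNr.
  by have := hl t a s 0; rewrite h00 !addr0 => ->; rewrite subrr.
- move=> a x s t; rewrite linearB linearZ !free_liftE /h0 /=.
  have h00 : h s 0 = 0.
    by have := hr s (-1) 0 0; rewrite scaler0 addr0 scaleN1r addNr.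
  by have := hr s a t 0; rewrite h00 !addr0 => ->; rewrite subrr.
- by move=> x y f s t; rewrite linearB !free_liftE /h0 /= hd subrr.
Qed.

Definition tens_lift : {linear tens -> V} := quot_lift tens_lift_subproof.

Lemma tens_liftE (x : C) (s : F x) (t : G x) : tens_lift (tens_el s t) = h s t.
Proof. by rewrite /tens_lift /tens_el quot_liftE free_liftE. Qed.

End Lift.

Lemma tens_el_linearl (x : C) (t : G x) : linear (fun s : F x => tens_el s t).
Proof.
have addl (s s' : F x) : tens_el (s + s') t = tens_el s t + tens_el s' t.
  apply/eqP; rewrite -subr_eq0 opprD addrA -!linearB /=; apply/eqP.
  rewrite -(linear0 (quot_pi (span_sub tens_rel))).
  by apply/quot_eqP; rewrite subr0; apply/span_sub_in/TensDl.
move=> a s s'; rewrite addl; congr (_ + _).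
apply/eqP; rewrite -subr_eq0 -linearZ -linearB /=; apply/eqP.
rewrite -(linear0 (quot_pi (span_sub tens_rel))).
by apply/quot_eqP; rewrite subr0; apply/span_sub_in/TensZl.
Qed.

Lemma tens_el_linearr (x : C) (s : F x) : linear (fun t : G x => tens_el s t).
Proof.
have addr (t t' : G x) : tens_el s (t + t') = tens_el s t + tens_el s t'.
  apply/eqP; rewrite -subr_eq0 opprD addrA -!linearB /=; apply/eqP.
  rewrite -(linear0 (quot_pi (span_sub tens_rel))).
  by apply/quot_eqP; rewrite subr0; apply/span_sub_in/TensDr.
move=> a t t'; rewrite addr; congr (_ + _).
apply/eqP; rewrite -subr_eq0 -linearZ -linearB /=; apply/eqP.
rewrite -(linear0 (quot_pi (span_sub tens_rel))).
by apply/quot_eqP; rewrite subr0; apply/span_sub_in/TensZr.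
Qed.

Lemma tens_el_dinat (x y : C) (f : hom x y) (s : F y) (t : G x) :
  tens_el (@kmap _ (opcat C) F y x f s) t = tens_el s (kmap G f t).
Proof. by apply/quot_eqP/span_sub_in/TensDinat. Qed.

End Tensor.
Arguments tens_lift : simpl never.

Section TensorMaps.
Variable k : fieldType.

Definition tens_mapr (C : cat) (F : kfunctor k (opcat C)) (G G' : kfunctor k C)
    (u : nattrans G G') : {linear tens F G -> tens F G'}.
Proof.
apply: (@tens_lift k C F G _ (fun x s t => tens_el s (u x t))).
- by move=> x t; apply: tens_el_linearl.
- by move=> x s a t t'; rewrite linearP tens_el_linearr.
- by move=> x y f s t; rewrite app_nat tens_el_dinat.
Defined.

Lemma tens_maprE (C : cat) (F : kfunctor k (opcat C)) (G G' : kfunctor k C)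
    (u : nattrans G G') (x : C) (s : F x) (t : G x) :
  tens_mapr F u (tens_el s t) = tens_el s (u x t).
Proof. exact: tens_liftE. Qed.

Definition tens_res (C D : cat) (p : functor C D) (F : kfunctor k (opcat D))
  (G : kfunctor k D) :
  {linear tens (pull (opfunctor p) F) (pull p G) -> tens F G}.
Proof.
apply: (@tens_lift k C (pull (opfunctor p) F) (pull p G) _
          (fun x s t => @tens_el k D F G (p x) s t)).
- by move=> x t; exact: (@tens_el_linearl k D F G (p x) t).
- by move=> x s; exact: (@tens_el_linearr k D F G (p x) s).
- by move=> x y f s t; exact: (@tens_el_dinat k D F G _ _ (fmor p f) s t).
Defined.

Lemma tens_resE (C D : cat) (p : functor C D) (F : kfunctor k (opcat D))
    (G : kfunctor k D) (x : C) (s : F (p x)) (t : G (p x)) :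
  tens_res p F G (@tens_el k C (pull (opfunctor p) F) (pull p G) x s t) =
  @tens_el k D F G (p x) s t.
Proof.
exact: (@tens_liftE k C (pull (opfunctor p) F) (pull p G) _
          (fun x s t => @tens_el k D F G (p x) s t)).
Qed.

End TensorMaps.
Arguments tens_mapr : simpl never.
Arguments tens_res : simpl never.

Section Resolutions.
Variables (k : fieldType) (C : cat).

(* Exactness, surjectivity and epimorphisms in k[C]-Mod are objectwise. *)
Definition nat_surj (F G : kfunctor k C) (u : nattrans F G) : Prop :=
  forall x (t : G x), exists s, u x s = t.

Definition projective (P : kfunctor k C) : Prop :=
  forall (M N : kfunctor k C) (e : nattrans M N) (u : nattrans P N),
    nat_surj e -> exists v : nattrans P M, nat_comp e v = u.

Record proj_res (F : kfunctor k C) := ProjRes {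
  res_obj :> nat -> kfunctor k C;
  res_d : forall n, nattrans (res_obj n.+1) (res_obj n);
  res_aug : nattrans (res_obj 0) F;
  res_proj : forall n, projective (res_obj n);
  res_aug_surj : nat_surj res_aug;
  res_exact0 : forall x (t : res_obj 0 x),
    res_aug x t = 0 <-> exists r, res_d 0 x r = t;
  res_exactS : forall n x (t : res_obj n.+1 x),
    res_d n x t = 0 <-> exists r, res_d n.+1 x r = t }.

Section Kernel.
Variables (F G : kfunctor k C) (u : nattrans F G).

Fact nat_ker_subproof x y (f : hom x y) (v : F x) :
  v \in ker_sub (u x) -> kmap F f v \in ker_sub (u y).
Proof. by rewrite !inE app_nat => /eqP->; rewrite linear0. Qed.

Definition nat_ker : kfunctor k C.
Proof.
refine (@KFunctor k C (fun x => sub_of (ker_sub (u x)))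
  (fun x y f => sub_map (nat_ker_subproof f)) _ _).
- by move=> x v; apply: val_inj; rewrite /= kmap1.
- by move=> x y z g f v; apply: val_inj; rewrite /= kmapM.
Defined.

Definition nat_ker_incl : nattrans nat_ker F.
Proof.
by refine (@Nattrans k C nat_ker F
  (fun x => (val : {linear sub_of (ker_sub (u x)) -> F x})) _).
Defined.

End Kernel.

(* The free functor on the elements of F, i.e. the direct sum of the standard
   projectives k[C(x, -)] over all x : C and s : F x; the generator
   [cgen s f] is the basis element f of the summand indexed by (x, s). *)
Section Cover.
Variable F : kfunctor k C.

Definition cover_gen (y : C) : choiceType :=
  {classic {x : C & (F x * hom x y)%type}}.
Definition cgen (x y : C) (s : F x) (f : hom x y) : cover_gen y :=
  existT (fun x : C => (F x * hom x y)%type) x (s, f).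

Definition cover_map (y z : C) (g : hom y z) :
  {linear {malg k[cover_gen y]} -> {malg k[cover_gen z]}} :=
  free_lift (fun c : cover_gen y =>
    << cgen (projT2 c).1 (compc g (projT2 c).2) >> : {malg k[cover_gen z]}).

Definition cover : kfunctor k C.
Proof.
refine (@KFunctor k C (fun y => {malg k[cover_gen y]}) cover_map _ _).
- move=> y v; suff -> : cover_map (idc y) = idfun by [].
  by apply: free_ext => -[x [s f]]; rewrite free_liftE /= comp1c.
- move=> x y z g f v.
  suff -> : cover_map (compc g f) = cover_map g \o cover_map f
    :> {linear _ -> _} by [].
  by apply: free_ext => -[w [s h]]; rewrite /= !free_liftE /= compcA.
Defined.

Definition cover_aug_map (y : C) : {linear {malg k[cover_gen y]} -> F y} :=
  free_lift (fun c : cover_gen y => kmap F (projT2 c).2 (projT2 c).1).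

Definition cover_aug : nattrans cover F.
Proof.
refine (@Nattrans k C cover F cover_aug_map _) => y z g v.
suff e : cover_aug_map z \o cover_map g = kmap F g \o cover_aug_map y
    :> {linear _ -> _}.
  exact: (congr1 (fun h : {linear _ -> _} => h v) e).
by apply: free_ext => -[x [s f]]; rewrite /= !free_liftE /= kmapM.
Defined.

Lemma cover_aug_surj : nat_surj cover_aug.
Proof.
by move=> x s; exists << cgen s (idc x) >>; rewrite /= free_liftE /= kmap1.
Qed.

Lemma cover_projective : projective cover.
Proof.
move=> M N e u e_surj.
pose e0 x (s : F x) : N x := u x << cgen s (idc x) >>.
have [m mE] : {m : forall x, F x -> M x | forall x s, e x (m x s) = e0 x s}.
  exists (fun x s => projT1 (cid (e_surj x (e0 x s)))) => x s.
  by case: cid.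
pose v y : {linear {malg k[cover_gen y]} -> M y} :=
  free_lift (fun c : cover_gen y => kmap M (projT2 c).2 (m _ (projT2 c).1)).
have v_nat y z (g : hom y z) (w : cover y) :
    v z (kmap cover g w) = kmap M g (v y w).
  suff e1 : v z \o cover_map g = kmap M g \o v y :> {linear _ -> _}.
    exact: (congr1 (fun h : {linear _ -> _} => h w) e1).
  by apply: free_ext => -[x [s f]]; rewrite /= !free_liftE /= kmapM.
exists (@Nattrans k C cover M v v_nat).
apply: nattrans_ext => y w /=.
suff e1 : e y \o v y = u y :> {linear _ -> _}.
  exact: (congr1 (fun h : {linear _ -> _} => h w) e1).
apply: free_ext => -[x [s f]]; rewrite /= free_liftE /= app_nat mE /e0.
by rewrite -app_nat /= free_liftE /= compc1.
Qed.

End Cover.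

Section Standard.
Variable F : kfunctor k C.

(* Each syzygy is the kernel of the free cover of the previous one; splicing
   the covers gives the projective resolution [std_res F]. *)
Fixpoint syzygy (n : nat) : kfunctor k C :=
  if n is m.+1 then nat_ker (cover_aug (syzygy m)) else F.

Definition std_obj (n : nat) : kfunctor k C := cover (syzygy n).
Definition std_d (n : nat) : nattrans (std_obj n.+1) (std_obj n) :=
  nat_comp (nat_ker_incl (cover_aug (syzygy n))) (cover_aug (syzygy n.+1)).

Lemma std_exact n x (t : std_obj n x) :
  cover_aug (syzygy n) x t = 0 <-> exists r, std_d n x r = t.
Proof.
split=> [t0|[r <-]]; last first.
  by apply/eqP; exact: (sub_valP (cover_aug (syzygy n.+1) x r)).
have tk : t \in ker_sub (cover_aug (syzygy n) x) by rewrite inE t0.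
have [r rE] := @cover_aug_surj (syzygy n.+1) x (SubOf tk).
by exists r; rewrite /std_d /= -/(std_obj n) [X in sub_val X]rE.
Qed.

Definition std_res : proj_res F.
Proof.
refine (@ProjRes F std_obj std_d (cover_aug F) _ _ _ _).
- by move=> n; apply: cover_projective.
- exact: cover_aug_surj.
- exact: (@std_exact 0).
- move=> n x t; apply: iff_trans (@std_exact n.+1 x t).
  split=> [h|h]; last by rewrite [LHS](congr1 val h).
  exact: val_inj.
Defined.

End Standard.
End Resolutions.

Section Lifts.
Variables (k : fieldType) (C D : cat) (p : functor C D).

(* Chain maps Q -> p^* P over the identity of p^* F. *)
Record res_lift (F : kfunctor k D) (Q : proj_res (pull p F)) (P : proj_res F) :=
  ResLift {
  lift_map :> forall n, nattrans (Q n) (pull p (P n));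
  lift_d : forall n, nat_comp (pull_nat p (res_d P n)) (lift_map n.+1) =
                     nat_comp (lift_map n) (res_d Q n);
  lift_aug : nat_comp (pull_nat p (res_aug P)) (lift_map 0) = res_aug Q }.

Section Cover.
Variables (M : kfunctor k C) (N : kfunctor k D) (u : nattrans M (pull p N)).

Definition cover_lift_map (y : C) :
    {linear {malg k[cover_gen M y]} -> {malg k[cover_gen N (p y)]}} :=
  free_lift (fun c : cover_gen M y =>
    << @cgen k D N (p (projT1 c)) (p y) (u _ (projT2 c).1)
         (fmor p (projT2 c).2) >>
      : {malg k[cover_gen N (p y)]}).

Definition cover_lift : nattrans (cover M) (pull p (cover N)).
Proof.
refine (@Nattrans k C (cover M) (pull p (cover N)) cover_lift_map _).
move=> y z g v.
suff e : cover_lift_map z \o cover_map M g =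
    cover_map N (fmor p g) \o cover_lift_map y :> {linear _ -> _}.
  exact: (congr1 (fun h : {linear _ -> _} => h v) e).
by apply: free_ext => -[x [s f]]; rewrite /= !free_liftE /= fmorM.
Defined.

Lemma cover_lift_aug :
  nat_comp (pull_nat p (cover_aug N)) cover_lift = nat_comp u (cover_aug M).
Proof.
apply: nattrans_ext => y v.
suff e : cover_aug_map N (p y) \o cover_lift_map y = u y \o cover_aug_map M y
    :> {linear _ -> _}.
  exact: (congr1 (fun h : {linear _ -> _} => h v) e).
by apply: free_ext => -[x [s f]]; rewrite /= !free_liftE /= app_nat.
Qed.

Fact ker_lift_subproof y (v : cover M y) :
  v \in ker_sub (cover_aug M y) ->
  cover_lift y v \in ker_sub (cover_aug N (p y)).
Proof.
rewrite !inE => /eqP v0.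
have /(congr1 (fun h : nattrans _ _ => h y v)) /= e := cover_lift_aug.
by rewrite [X in X == _]e [cover_aug_map M y v]v0 linear0.
Qed.

Definition ker_lift :
  nattrans (nat_ker (cover_aug M)) (pull p (nat_ker (cover_aug N))).
Proof.
refine (@Nattrans k C (nat_ker (cover_aug M)) (pull p (nat_ker (cover_aug N)))
  (fun y => sub_map (@ker_lift_subproof y)) _).
by move=> y z g v; apply: val_inj; exact: (app_nat cover_lift).
Defined.

End Cover.

Variable F : kfunctor k D.

Fixpoint syzygy_lift (n : nat) :
    nattrans (syzygy (pull p F) n) (pull p (syzygy F n)) :=
  if n is m.+1 return nattrans (syzygy (pull p F) n) (pull p (syzygy F n))
  then ker_lift (syzygy_lift m) else nat_id (pull p F).

Definition std_lift : res_lift (std_res (pull p F)) (std_res F).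
Proof.
refine (@ResLift F (std_res (pull p F)) (std_res F)
  (fun n => cover_lift (syzygy_lift n)) _ _).
- move=> n; apply: nattrans_ext => x v.
  have /(congr1 (fun h : nattrans _ _ => h x v)) e :=
    cover_lift_aug (syzygy_lift n.+1).
  exact: (congr1 val e).
- rewrite [LHS](cover_lift_aug (syzygy_lift 0)).
  by apply: nattrans_ext.
Defined.

End Lifts.

Section Ext.
Variable k : fieldType.

Section ExtOf.
Variables (C : cat) (F : kfunctor k C) (P : proj_res F) (G : kfunctor k C).

Definition Ext_cob (n : nat) : submodClosed (nattrans (P n) G) :=
  match n return submodClosed (nattrans (P n) G) with
  | 0 => @zero_sub k (nattrans (P 0) G)
  | m.+1 => im_sub (precomp G (res_d P m))
  end.

Definition Ext_of (n : nat) : lmodType k :=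
  subquo (ker_sub (precomp G (res_d P n))) (Ext_cob n).

End ExtOf.

(* Ext^n_{k[C]}(F, G) is the n-th cohomology of Hom(P, G) for the projective
   resolution P = std_res F. *)
Definition Ext (C : cat) (F G : kfunctor k C) (n : nat) : lmodType k :=
  Ext_of (std_res F) G n.

Section ExtRes.
Variables (C D : cat) (p : functor C D) (F : kfunctor k D).
Variables (Q : proj_res (pull p F)) (P : proj_res F) (L : res_lift Q P).
Variable G : kfunctor k D.

Definition Ext_cochain (n : nat) :
  {linear nattrans (P n) G -> nattrans (Q n) (pull p G)} :=
  precomp (pull p G) (L n) \o pull_nat p.

Lemma Ext_cochain_d n (v : nattrans (P n) G) :
  precomp (pull p G) (res_d Q n) (Ext_cochain n v) =
  Ext_cochain n.+1 (precomp G (res_d P n) v).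
Proof.
apply: nattrans_ext => x s /=.
have /(congr1 (fun h : nattrans _ _ => h x s)) /= e := lift_d L n.
by rewrite -e.
Qed.

Fact Ext_cochain_cocycle n (v : nattrans (P n) G) :
  v \in ker_sub (precomp G (res_d P n)) ->
  Ext_cochain n v \in ker_sub (precomp (pull p G) (res_d Q n)).
Proof.
move=> /eqP v0; apply/eqP; apply: etrans (Ext_cochain_d v) _.
by apply: etrans (congr1 (@Ext_cochain n.+1) v0) _; rewrite linear0.
Qed.

Fact Ext_cochain_coboundary n (v : nattrans (P n) G) :
  v \in Ext_cob P G n -> Ext_cochain n v \in Ext_cob Q (pull p G) n.
Proof.
case: n v => [|n] v.
  by move=> /eqP v0; apply/eqP; rewrite v0 linear0.
move=> /asboolP[w <-]; apply/asboolP; exists (Ext_cochain n w).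
exact: Ext_cochain_d.
Qed.

Definition Ext_res_of (n : nat) :
  {linear Ext_of P G n -> Ext_of Q (pull p G) n} :=
  subquo_map (@Ext_cochain_cocycle n) (@Ext_cochain_coboundary n).

End ExtRes.

(* The map p^* : Ext^n_{k[D]}(F, G) -> Ext^n_{k[C]}(p^* F, p^* G), induced by
   Hom(P, G) -> Hom(p^* P, p^* G) -> Hom(Q, p^* G), where the second arrow is
   precomposition with a comparison Q -> p^* P of resolutions. *)
Definition Ext_res (C D : cat) (p : functor C D) (F G : kfunctor k D)
    (n : nat) : {linear Ext F G n -> Ext (pull p F) (pull p G) n} :=
  Ext_res_of (std_lift p F) G n.

End Ext.

Section Tor.
Variable k : fieldType.

Section TorOf.
Variables (C : cat) (F : kfunctor k (opcat C)) (G : kfunctor k C).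
Variable P : proj_res G.

Definition Tor_cycle (n : nat) : submodClosed (tens F (P n)) :=
  match n return submodClosed (tens F (P n)) with
  | 0 => @full_sub k (tens F (P 0))
  | m.+1 => ker_sub (tens_mapr F (res_d P m))
  end.

Definition Tor_of (n : nat) : lmodType k :=
  subquo (Tor_cycle n) (im_sub (tens_mapr F (res_d P n))).

End TorOf.

(* Tor_n^{k[C]}(F, G), the left derived functor of F \otimes_{k[C]} - at G. *)
Definition Tor (C : cat) (F : kfunctor k (opcat C)) (G : kfunctor k C)
  (n : nat) : lmodType k := Tor_of F (std_res G) n.

Section TorRes.
Variables (C D : cat) (p : functor C D).
Variables (F : kfunctor k (opcat D)) (G : kfunctor k D).
Variables (Q : proj_res (pull p G)) (P : proj_res G) (L : res_lift Q P).

Definition Tor_chain (n : nat) :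
  {linear tens (pull (opfunctor p) F) (Q n) -> tens F (P n)} :=
  tens_res p F (P n) \o tens_mapr (pull (opfunctor p) F) (L n).

Lemma Tor_chain_d n (t : tens (pull (opfunctor p) F) (Q n.+1)) :
  tens_mapr F (res_d P n) (Tor_chain n.+1 t) =
  Tor_chain n (tens_mapr (pull (opfunctor p) F) (res_d Q n) t).
Proof.
suff e : tens_mapr F (res_d P n) \o Tor_chain n.+1 =
    Tor_chain n \o tens_mapr (pull (opfunctor p) F) (res_d Q n)
    :> {linear _ -> _}.
  exact: (congr1 (fun h : {linear _ -> _} => h t) e).
apply: tens_ext => x s v.
have e : res_d P n (p x) (L n.+1 x v) = L n x (res_d Q n x v).
  exact: (congr1 (fun h : nattrans _ _ => h x v) (lift_d L n)).
pose pF := pull (opfunctor p) F.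
have E m (w : Q m x) : Tor_chain m (@tens_el k C pF (Q m) x s w) =
    @tens_el k D F (P m) (p x) s (L m x w).
  apply: etrans (congr1 (tens_res p F (P m)) (tens_maprE (L m) s w)) _.
  exact: tens_resE.
apply: etrans (congr1 (tens_mapr F (res_d P n)) (E n.+1 v)) _.
apply: etrans (@tens_maprE k D F _ _ (res_d P n) (p x) s _) _.
apply: etrans (congr1 (fun w => @tens_el k D F (P n) (p x) s w) e) _.
apply: esym; apply: etrans (congr1 (@Tor_chain n) (tens_maprE _ s v)) _.
exact: E.
Qed.

Fact Tor_chain_cycle n (t : tens (pull (opfunctor p) F) (Q n)) :
  t \in Tor_cycle (pull (opfunctor p) F) Q n ->
  Tor_chain n t \in Tor_cycle F P n.
Proof.
case: n t => [//|n] t /eqP t0; apply/eqP; apply: etrans (Tor_chain_d t) _.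
by apply: etrans (congr1 (@Tor_chain n) t0) _; rewrite linear0.
Qed.

Fact Tor_chain_boundary n (t : tens (pull (opfunctor p) F) (Q n)) :
  t \in im_sub (tens_mapr (pull (opfunctor p) F) (res_d Q n)) ->
  Tor_chain n t \in im_sub (tens_mapr F (res_d P n)).
Proof.
move=> /asboolP[w <-]; apply/asboolP; exists (Tor_chain n.+1 w).
exact: Tor_chain_d.
Qed.

Definition Tor_res_of (n : nat) :
  {linear Tor_of (pull (opfunctor p) F) Q n -> Tor_of F P n} :=
  subquo_map (@Tor_chain_cycle n) (@Tor_chain_boundary n).

End TorRes.

(* The map res^p, induced by
   p^*F \otimes Q -> p^*F \otimes p^*P -> F \otimes P,
   where the last arrow sends the class of s \otimes t to its class. *)
Definition Tor_res (C D : cat) (p : functor C D) (F : kfunctor k (opcat D))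
    (G : kfunctor k D) (n : nat) :
    {linear Tor (pull (opfunctor p) F) (pull p G) n -> Tor F G n} :=
  Tor_res_of F (std_lift p G) n.

End Tor.

(* Main.v *)
From HB Require Import structures.
Require Import Defs.
From mathcomp Require Import all_boot all_algebra finmap.
From mathcomp.multinomials Require Import monalg.
From mathcomp Require Import boolp classical_sets cardinality.
Import Defs.

Set Implicit Arguments.
Unset Strict Implicit.
Unset Printing Implicit Defensive.

Import GRing.Theory.
Local Open Scope ring_scope.

(** The pullback p^* along a full and essentially surjective functor p has a
    left adjoint p_! with the explicit form p_! G = G / J G, where J G (x) is
    spanned by the differences G(f) s - G(g) s with p(f) = p(g).  If Q is a
    projective resolution of p^* F, then p_! Q consists of projectives, and
    Hom(Q, p^* G) = Hom(p_! Q, G), p^* F tensor Q = F tensor p_! Q.  So as soon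
    as p_! Q is still a resolution of F, the comparison theorem for projective
    resolutions gives both isomorphisms ([Ext_res_of_bij], [Tor_res_of_bij]).
    That p_! Q is exact means that p^* F is acyclic for p_!, and this is the
    substance of the proof ([acyclic_pull]).

    Acyclicity is the vanishing of the derived functors of p_! up to a given
    degree.  It is encoded without derived functors: G = P / K with P
    projective is acyclic in degree 1 when K meets J P in J K, and the higher
    degrees are those of K ([acyclic]).  The usual long exact sequence arguments
    become statements about such extensions.

    The key case is G = k[M], the free module on the elements of an additive
    functor M from A to abelian groups ([acyclic_kfree]), by induction on the
    degree for all M at once.  As acyclicity passes to directed unions, M may be
    taken cyclic, M = A(x, -) / N.  The bar complex of the translation action of
    N on A(x, -) resolves k[M] by the functors k[A(x, -) x N^j].  The term j = 0
    is projective and the others are acyclic in lower degrees by induction, so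
    that it only remains to see that p_! preserves the exactness of this
    complex.  Now p_! k[M] = k[M / I M], where I M consists of the values on M
    of the morphisms that p kills; p_! therefore turns the bar complex into
    the one of the group N / I N acting on A(x, -) / I A(x, -).  Its homology is
    the homology of the stabilizers with coefficients in k.  Each identity of B
    is killed by some n invertible in k ([k_trivial_torsion]), so that these
    groups are of exponent n, and averaging over n-torsion elements contracts
    the complex ([bar_exact]).

    For M = B(b, p -) this shows that the pulled back standard projectives of
    k[B]-Mod are acyclic.  Since J vanishes on pulled back functors, acyclicity
    then climbs along a presentation of an arbitrary F by these projectives. *)

Definition lin_of (R : nzRingType) (U V : lmodType R) (f : U -> V)
  (lf : linear f) : {linear U -> V} := HB.pack f (GRing.isLinear.Build R U V _ f lf).

Lemma malgUZ (R : nzRingType) (S : choiceType) (a : R) (s : S) :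
  << a *g s >> = a *: << s >> :> {malg R[S]}.
Proof. by apply/malgP => t; rewrite mcoeffZ !mcoeffU mulrnAr mulr1. Qed.

(** * Short exact sequences and projective functors *)

Section ShortExact.
Variables (k : fieldType) (C : cat).
Implicit Types F G K E M P : kfunctor k C.

Lemma nat_eqE F G (u v : nattrans F G) : u = v -> forall x s, u x s = v x s.
Proof. by move=> ->. Qed.

Lemma proj_lift P M N (e : nattrans M N) (u : nattrans P N) :
  projective P -> nat_surj e ->
  exists v : nattrans P M, forall x s, e x (v x s) = u x s.
Proof.
move=> pP se; have [v ev] := pP _ _ e u se.
by exists v => x s; rewrite -ev.
Qed.

Definition nat_inj F G (u : nattrans F G) : Prop :=
  forall x (s : F x), u x s = 0 -> s = 0.

Lemma nat_injP F G (u : nattrans F G) x : nat_inj u -> injective (u x).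
Proof.
by move=> iu s t e; apply/eqP; rewrite -subr_eq0 (iu x (s - t)) // linearB e subrr.
Qed.

Record ses K E G (i : nattrans K E) (e : nattrans E G) : Prop := Ses {
  ses_inj : nat_inj i;
  ses_surj : nat_surj e;
  ses_ker : forall x t, e x t = 0 -> exists s, i x s = t;
  ses_im : forall x s, e x (i x s) = 0 }.

Lemma ses_nat_ker E G (e : nattrans E G) :
  nat_surj e -> ses (nat_ker_incl e) e.
Proof.
move=> se; split=> //.
- by move=> x s /= s0; apply: val_inj; rewrite /= s0.
- move=> x t t0; have tk : t \in ker_sub (e x) by rewrite inE t0.
  by exists (SubOf tk).
- by move=> x s; apply/eqP; exact: (sub_valP s).
Qed.

Lemma ses_factor K E G M (i : nattrans K E) (e : nattrans E G)
    (v : nattrans M E) :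
  ses i e -> (forall x s, e x (v x s) = 0) ->
  exists w : nattrans M K, forall x s, i x (w x s) = v x s.
Proof.
move=> S ev0.
pose w x s := projT1 (cid (ses_ker S (ev0 x s))).
have wE x s : i x (w x s) = v x s by rewrite /w; case: cid.
have ii x := @nat_injP _ _ i x (ses_inj S).
have lw x : linear (w x).
  by move=> a s t; apply: (ii x); rewrite linearP !wE linearP.
suff nw : forall x y (f : hom x y) (s : M x),
    lin_of (lw y) (kmap M f s) = kmap K f (lin_of (lw x) s).
  by exists (@Nattrans k C M K (fun x => lin_of (lw x)) nw).
by move=> x y f s; apply: (ii y); rewrite /= wE !app_nat wE.
Qed.

Fact nat_sum_linear F G x y (f : hom x y) :
  linear (fun s : (F x * G x)%type => (kmap F f s.1, kmap G f s.2)).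
Proof. by move=> a u v; rewrite !linearP. Qed.

Definition nat_sum F G : kfunctor k C.
Proof.
refine (@KFunctor k C (fun x => (F x * G x)%type)
  (fun x y f => lin_of (@nat_sum_linear F G x y f)) _ _).
- by move=> x [u v]; rewrite /= !kmap1.
- by move=> x y z g f [u v]; rewrite /= !kmapM.
Defined.

Fact nat_pair_linear M F G (u : nattrans M F) (v : nattrans M G) x :
  linear (fun s : M x => (u x s, v x s)).
Proof. by move=> a s t; rewrite !linearP. Qed.

Definition nat_pair M F G (u : nattrans M F) (v : nattrans M G) :
  nattrans M (nat_sum F G).
Proof.
refine (@Nattrans k C M (nat_sum F G) (fun x => lin_of (@nat_pair_linear M F G u v x)) _).
by move=> x y f s; rewrite /= !app_nat.
Defined.

Fact nat_copair_linear M F G (u : nattrans F M) (v : nattrans G M) x :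
  linear (fun s : (F x * G x)%type => u x s.1 + v x s.2).
Proof. by move=> a s t; rewrite !linearP /= scalerDr addrACA. Qed.

Definition nat_copair M F G (u : nattrans F M) (v : nattrans G M) :
  nattrans (nat_sum F G) M.
Proof.
refine (@Nattrans k C (nat_sum F G) M
  (fun x => lin_of (@nat_copair_linear M F G u v x)) _).
by move=> x y f s; rewrite /= !app_nat linearD.
Defined.

Definition nat_in1 F G := nat_pair (nat_id F) (nat_zero F G).
Definition nat_in2 F G := nat_pair (nat_zero G F) (nat_id G).
Definition nat_pr1 F G := nat_copair (nat_id F) (nat_zero G F).
Definition nat_pr2 F G := nat_copair (nat_zero F G) (nat_id G).

Lemma ses_sum F G : ses (nat_in1 F G) (nat_pr2 F G).
Proof.
split.
- by move=> x s /= [].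
- by move=> x t; exists (0, t); rewrite /= add0r.
- by move=> x [s t] /=; rewrite add0r => ->; exists s.
- by move=> x s; rewrite /= addr0.
Qed.

Lemma projective_retract P Q (i : nattrans P Q) (r : nattrans Q P) :
  (forall x s, r x (i x s) = s) -> projective Q -> projective P.
Proof.
move=> ri pQ M N e u se; have [v vE] := proj_lift (nat_comp u r) pQ se.
by exists (nat_comp v i); apply: nattrans_ext => x s; rewrite /= vE /= ri.
Qed.

Lemma projective_sum P Q : projective P -> projective Q -> projective (nat_sum P Q).
Proof.
move=> pP pQ M N e u se.
have [v vE] := proj_lift (nat_comp u (nat_in1 P Q)) pP se.
have [w wE] := proj_lift (nat_comp u (nat_in2 P Q)) pQ se.
exists (nat_copair v w); apply: nattrans_ext => x [s t].
by rewrite /= linearD vE wE /= -linearD /= -[(s, 0) + _]/(s + 0, 0 + t) addr0 add0r.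
Qed.

(** A surjection onto a projective splits, so its kernel is a retract. *)
Lemma projective_ker P Q (u : nattrans P Q) :
  nat_surj u -> projective P -> projective Q -> projective (nat_ker u).
Proof.
move=> su pP pQ; have [t tE] := proj_lift (nat_id Q) pQ su.
pose v : nattrans P P := nat_add (nat_id P) (nat_opp (nat_comp t u)).
have v0 x s : u x (v x s) = 0 by rewrite /= linearB tE subrr.
have [r rE] := ses_factor (ses_nat_ker su) v0.
apply: (projective_retract (i := nat_ker_incl u) (r := r)) pP => x s.
apply: val_inj; rewrite [LHS]rE /=.
by rewrite (ses_im (ses_nat_ker su)) linear0 subr0.
Qed.

End ShortExact.

(** * Acyclicity for the left adjoint of the pullback *)

Section Quotient.
Variables (k : fieldType) (C D : cat) (p : functor C D).
Implicit Types F G K E M P : kfunctor k C.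

(** Generators of J G (x), the kernel of G(x) -> p_! G (p x) when p is full and
    essentially surjective: the quotient G / J G is the largest one on which
    morphisms with the same image under p act in the same way. *)
Definition J_gen G (x : C) (t : G x) : Prop :=
  exists z (f g : hom z x) (s : G z),
    fmor p f = fmor p g /\ t = kmap G f s - kmap G g s.

Notation J G x := (span_sub (@J_gen G x)).

Lemma J_min G x (S : submodClosed (G x)) :
  (forall t, J_gen t -> t \in S) -> forall t, t \in J G x -> t \in S.
Proof. by move=> h t /asboolP; apply. Qed.

Lemma J_in G z x (f g : hom z x) (s : G z) :
  fmor p f = fmor p g -> kmap G f s - kmap G g s \in J G x.
Proof. by move=> fg; apply: span_sub_in; exists z, f, g, s. Qed.

Lemma J_nat G M (u : nattrans G M) x t : t \in J G x -> u x t \in J M x.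
Proof.
pose S := preim_sub (u x) (J M x).
apply: (@J_min G x S) => _ [z [f [g [s [fg ->]]]]].
by change (u x (kmap G f s - kmap G g s) \in J M x); rewrite linearB !app_nat J_in.
Qed.

(** With [J_nat], the right exactness of G |-> G / J G. *)
Lemma J_lift G M (u : nattrans G M) x t : nat_surj u ->
  t \in J M x -> exists2 s, s \in J G x & u x s = t.
Proof.
move=> su tJ.
suff : t \in im_sub (u x \o (val : {linear sub_of (J G x) -> G x})).
  by move=> /asboolP[[s sJ] /= <-]; exists s.
move: t tJ; apply: J_min => _ [z [f [g [s [fg ->]]]]].
have [r <-] := su z s; apply/asboolP.
by exists (SubOf (J_in r fg)); rewrite /= linearB !app_nat.
Qed.

Lemma J_pull (F : kfunctor k D) (x : C) (t : pull p F x) :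
  t \in span_sub (@J_gen (pull p F) x) -> t = 0.
Proof.
move=> tJ; apply/eqP; suff : t \in @zero_sub k (F (p x)) by [].
move: t tJ; apply: (@J_min (pull p F)) => _ [z [f [g [s [fg ->]]]]].
by rewrite inE /= fg subrr.
Qed.

(** Exactness on the left of K / J K -> E / J E.  When E is projective with
    quotient G, this is the vanishing of the first derived functor at G. *)
Definition pure K E (i : nattrans K E) : Prop :=
  forall x s, i x s \in J E x -> s \in J K x.

(** The derived functors of G |-> G / J G vanish in degrees 1, ..., n.  They
    are read off one projective presentation of G and, by dimension shift, its
    kernel; the presentation is left existential, so that extensions and
    quotients can use the one that suits them. *)
Fixpoint acyclic (n : nat) G : Prop :=
  if n is m.+1 then
    exists K P (i : nattrans K P) (e : nattrans P G),
      [/\ ses i e, projective P, pure i & acyclic m K]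
  else True.

(** The vanishing of the first derived functor does not depend on the
    presentation, even among presentations by a functor E that is not
    projective.  If f lifts P to E over G, then J E = f(J P) + J L.  When such
    a sum f(w) + m lies in L, the element w lies in K and in J P, hence in J K,
    and f maps K to L. *)
Lemma pure_ses G K P (i : nattrans K P) (e : nattrans P G)
    L E (j : nattrans L E) (q : nattrans E G) :
  ses i e -> projective P -> pure i -> ses j q -> pure j.
Proof.
move=> S pP pi T x l lJ.
have [f fE] := proj_lift e pP (ses_surj T).
have split_J t : t \in J E x -> exists2 w, w \in J P x &
    exists2 m, m \in J L x & t = f x w + j x m.
  pose g : {linear (sub_of (J P x) * sub_of (J L x))%type -> E x} :=
    (f x \o (val \o fst)) \+ (j x \o (val \o snd)).
  move=> tJ; suff : t \in im_sub g.
    by move=> /asboolP[[[w wJ] [m mJ]] /= <-]; exists w => //; exists m.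
  move: t tJ; apply: J_min => _ [z [h [h' [s [hh' ->]]]]].
  have [r rE] := ses_surj S (q z s).
  have [m mE] : exists m, j z m = s - f z r.
    by apply: (ses_ker T); rewrite linearB fE rE subrr.
  apply/asboolP; exists (SubOf (J_in r hh'), SubOf (J_in m hh')); rewrite /= !linearB !app_nat mE.
  by rewrite addrACA -opprD -!linearD /= (addrC (f z r)) subrK.
have [w wJ [m mJ lE]] := split_J _ lJ.
have [v vE] : exists v, i x v = w.
  apply: (ses_ker S); rewrite -fE.
  have -> : f x w = j x l - j x m by rewrite lE addrK.
  by rewrite linearB !(ses_im T) subr0.
have fi0 y s : q y (nat_comp f i y s) = 0 by rewrite /= fE (ses_im S).
have [h hE] := ses_factor T fi0.
have -> : l = h x v + m.
  by apply: (nat_injP (ses_inj T)); rewrite lE linearD hE /= vE.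
by rewrite rpredD // J_nat // pi // vE.
Qed.

(** Schanuel's lemma: higher acyclicity can be tested on any projective
    presentation L -> Q -> G.  If K2 -> P2 -> K presents the kernel K of another
    presentation P -> G, then L is presented by K2 -> U -> L, where U is the
    kernel of a surjection P2 + Q -> P and so projective. *)
Lemma acyclic_syzygy n G L Q (j : nattrans L Q) (q : nattrans Q G) :
  acyclic n.+1 G -> projective Q -> ses j q -> pure j /\ acyclic n L.
Proof.
move=> [K [P [i [e [S pP pi aK]]]]] pQ T; split; first exact: pure_ses S pP pi T.
case: n aK => [//|n] [K2 [P2 [i2 [e2 [S2 pP2 pi2 aK2]]]]].
have [f fE] := proj_lift q pQ (ses_surj S).
have [g gE] := proj_lift e pP (ses_surj T).
pose u : nattrans (nat_sum P2 Q) P := nat_copair (nat_comp i e2) f.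
have su : nat_surj u.
  move=> x s; have [b bE] := ses_surj T (e x s).
  have [c cE] : exists c, i x c = s - f x b.
    by apply: (ses_ker S); rewrite linearB fE bE subrr.
  by have [a aE] := ses_surj S2 c; exists (a, b); rewrite /= aE cE subrK.
have pU := projective_ker su (projective_sum pP2 pQ) pP.
have SU := ses_nat_ker su.
have q0 x s : q x (nat_comp (nat_pr2 P2 Q) (nat_ker_incl u) x s) = 0.
  have := ses_im SU s; rewrite /= add0r => h.
  by rewrite -fE -(addKr (i x (e2 x (val s).1)) (f x _)) h addr0 linearN (ses_im S) oppr0.
have [r rE] := ses_factor T q0.
have u0 x s : u x (nat_comp (nat_in1 P2 Q) i2 x s) = 0.
  by rewrite /= (ses_im S2) !linear0 addr0.
have [i3 i3E] := ses_factor SU u0.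
exists K2, (nat_ker u), i3, r; split=> //; last first.
  move=> x s /(J_nat (nat_comp (nat_pr1 P2 Q) (nat_ker_incl u))).
  by move: (i3E x s) => /= ->; rewrite /= addr0 => /pi2.
split.
- move=> x s s0; apply: (ses_inj S2); move: (i3E x s); rewrite s0 linear0 /=.
  by move=> [].
- move=> x l; have [c cE] : exists c, i x c = f x (j x l).
    by apply: (ses_ker S); rewrite fE (ses_im T).
  have [a aE] := ses_surj S2 (- c).
  have [|w wE] := @ses_ker _ _ _ _ _ _ _ SU x (a, j x l).
    by rewrite /= aE linearN cE addNr.
  by exists w; apply: (nat_injP (ses_inj T)); rewrite rE /= [sub_val _]wE add0r.
- move=> x w w0; have := rE x w; rewrite w0 linear0 /= add0r => w2.
  have := ses_im SU w; rewrite /= -w2 linear0 addr0.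
  move=> /(ses_inj S) /(ses_ker S2)[s sE].
  exists s; apply: val_inj; rewrite [LHS]i3E /= sE w2.
  by case: (sub_val w).
- move=> x s; apply: (nat_injP (ses_inj T)); rewrite rE /= linear0.
  by move: (i3E x s) => /= ->; rewrite /= addr0.
Qed.


Lemma acyclic_proj n P : projective P -> acyclic n P.
Proof.
elim: n P => // n IHn P pP.
have sid : nat_surj (nat_id P) by move=> x t; exists t.
have S := ses_nat_ker sid.
exists (nat_ker (nat_id P)), P, (nat_ker_incl (nat_id P)), (nat_id P); split=> //.
- move=> x s _; suff -> : s = 0 by rewrite rpred0.
  by apply: (ses_inj S); have := ses_im S s.
- exact/IHn/projective_ker.
Qed.

Lemma acyclicW n G : acyclic n.+1 G -> acyclic n G.
Proof.
elim: n G => // n IHn G [K [P [i [e [S pP pi aK]]]]].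
by exists K, P, i, e; split=> //; apply: IHn.
Qed.

Lemma acyclic_le m n G : (m <= n)%N -> acyclic n G -> acyclic m G.
Proof.
elim: n => [|n IHn]; first by rewrite leqn0 => /eqP->.
by rewrite leq_eqVlt => /orP[/eqP->//|/IHn h /acyclicW].
Qed.

(** The horseshoe lemma: presentations P1 of K and P2 of G add up to a
    presentation of E, and the kernels form an extension again. *)
Lemma acyclic_ext n K E G (i : nattrans K E) (e : nattrans E G) :
  ses i e -> acyclic n K -> acyclic n G -> acyclic n E.
Proof.
elim: n K E G i e => // n IHn K E G i e S.
move=> [K1 [P1 [i1 [e1 [S1 pP1 pi1 aK1]]]]] [K2 [P2 [i2 [e2 [S2 pP2 pi2 aK2]]]]].
have [l lE] := proj_lift e2 pP2 (ses_surj S).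
pose q : nattrans (nat_sum P1 P2) E := nat_copair (nat_comp i e1) l.
have qE x s t : q x (s, t) = i x (e1 x s) + l x t by [].
have sq : nat_surj q.
  move=> x t; have [b bE] := ses_surj S2 (e x t).
  have [c cE] : exists c, i x c = t - l x b.
    by apply: (ses_ker S); rewrite linearB lE bE subrr.
  by have [a aE] := ses_surj S1 c; exists (a, b); rewrite qE aE cE subrK.
have T := ses_nat_ker sq.
have [u uE] : exists u : nattrans K1 (nat_ker q),
    forall x s, nat_ker_incl q x (u x s) = (i1 x s, 0).
  have q0 x s : q x (nat_comp (nat_in1 P1 P2) i1 x s) = 0.
    by rewrite /= (ses_im S1) !linear0 addr0.
  by have [u uE] := ses_factor T q0; exists u.
have [v vE] : exists v : nattrans (nat_ker q) K2,
    forall x s, i2 x (v x s) = (nat_ker_incl q x s).2.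
  have e20 x s : e2 x (nat_comp (nat_pr2 P1 P2) (nat_ker_incl q) x s) = 0.
    have /(congr1 (e x)) := ses_im T s.
    by rewrite linear0 /= linearD (ses_im S) !add0r lE.
  by have [v vE] := ses_factor S2 e20; exists v => x s; rewrite vE /= add0r.
have U : ses u v.
  split.
  - move=> x s s0; apply: (ses_inj S1); have := uE x s; rewrite s0 linear0.
    by move=> [].
  - move=> x t; have [c cE] : exists c, i x c = l x (i2 x t).
      by apply: (ses_ker S); rewrite lE (ses_im S2).
    have [a aE] := ses_surj S1 (- c).
    have [|w wE] := @ses_ker _ _ _ _ _ _ _ T x (a, i2 x t).
      by rewrite qE aE linearN cE addNr.
    by exists w; apply: (nat_injP (ses_inj S2)); rewrite vE wE.
  - move=> x w w0; have := ses_im T w; have := vE x w; rewrite w0 linear0.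
    case wE: (nat_ker_incl q x w) => [a b] /= b0; rewrite -b0 linear0 addr0.
    move=> /(ses_inj S) /(ses_ker S1)[s sE].
    by exists s; apply: (nat_injP (ses_inj T)); rewrite uE sE wE -b0.
  - by move=> x s; apply: (nat_injP (ses_inj S2)); rewrite vE uE linear0.
have aKq : acyclic n (nat_ker q) by apply: IHn U _ _.
exists (nat_ker q), (nat_sum P1 P2), (nat_ker_incl q), q.
split=> //; first exact: projective_sum.
move=> x w wJ.
have : v x w \in J K2 x.
  by apply: pi2; rewrite vE; have := J_nat (nat_pr2 P1 P2) wJ; rewrite /= add0r.
move=> /(J_lift (ses_surj U))[w' w'J w'E].
have [s sE] : exists s, u x s = w - w'.
  by apply: (ses_ker U); rewrite linearB w'E subrr.
suff : s \in J K1 x by move=> /(J_nat u) sJ; rewrite -(subrK w' w) -sE rpredD.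
apply: pi1; have -> : i1 x s = nat_pr1 P1 P2 x (nat_ker_incl q x (u x s)).
  by rewrite uE /= addr0.
by apply: J_nat; rewrite sE linearB rpredB //; apply: J_nat.
Qed.

(** The long exact sequence K -> E -> G: acyclicity of G one degree higher than
    that of K, at the price of injectivity of K / J K -> E / J E.  A
    presentation of E presents G, and its new kernel is an extension of K by
    the old one. *)
Lemma acyclic_quot n K E G (i : nattrans K E) (e : nattrans E G) :
  ses i e -> pure i -> acyclic n K -> acyclic n.+1 E -> acyclic n.+1 G.
Proof.
move=> S pi aK [KE [P [j [q [T pP pj aKE]]]]].
pose r := nat_comp e q.
have sr : nat_surj r.
  move=> x t; have [s sE] := ses_surj S t; have [a aE] := ses_surj T s.
  by exists a; rewrite /= aE.
have U := ses_nat_ker sr.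
have [u uE] : exists u : nattrans KE (nat_ker r),
    forall x s, nat_ker_incl r x (u x s) = j x s.
  by apply: (ses_factor U) => x s; rewrite /= (ses_im T) linear0.
have [v vE] : exists v : nattrans (nat_ker r) K,
    forall x s, i x (v x s) = q x (nat_ker_incl r x s).
  have e0 x s : e x (nat_comp q (nat_ker_incl r) x s) = 0 by exact: (ses_im U s).
  by have [v vE] := ses_factor S e0; exists v.
have V : ses u v.
  split.
  - by move=> x s s0; apply: (ses_inj T); rewrite -uE s0 linear0.
  - move=> x t; have [a aE] := ses_surj T (i x t).
    have [|w wE] := @ses_ker _ _ _ _ _ _ _ U x a.
      by rewrite /= aE (ses_im S).
    by exists w; apply: (nat_injP (ses_inj S)); rewrite vE wE.
  - move=> x w w0; have := vE x w; rewrite w0 linear0 => /esym.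
    move=> /(ses_ker T)[s sE]; exists s; apply: (nat_injP (ses_inj U)).
    by rewrite uE.
  - by move=> x s; apply: (nat_injP (ses_inj S)); rewrite vE uE linear0 (ses_im T).
exists (nat_ker r), P, (nat_ker_incl r), r; split=> //; last exact: acyclic_ext V _ _.
move=> x w wJ.
have : v x w \in J K x by apply: pi; rewrite vE J_nat.
move=> /(J_lift (ses_surj V))[w' w'J w'E].
have [s sE] : exists s, u x s = w - w'.
  by apply: (ses_ker V); rewrite linearB w'E subrr.
suff : s \in J KE x by move=> /(J_nat u) sJ; rewrite -(subrK w' w) -sE rpredD.
by apply: pj; rewrite -uE sE linearB rpredB //; apply: J_nat.
Qed.

(** A resolution X of G that stays exact modulo J computes the derived functors
    as soon as X j is acyclic up to degree n - j.  In the hypercohomology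
    spectral sequence only the row of degree 0 would be left, and it is exact.
    Peeling off one kernel at a time replaces the spectral sequence. *)
Lemma acyclic_resolution n (X : nat -> kfunctor k C)
    (d : forall j, nattrans (X j.+1) (X j)) G (e : nattrans (X 0%N) G) :
  nat_surj e ->
  (forall x t, e x t = 0 <-> exists r, d 0%N x r = t) ->
  (forall j x t, d j x t = 0 <-> exists r, d j.+1 x r = t) ->
  (forall j x (t : X j.+1 x), d j x t \in J (X j) x ->
     exists r, t - d j.+1 x r \in J (X j.+1) x) ->
  (forall j, (j <= n)%N -> acyclic (n - j) (X j)) ->
  acyclic n G.
Proof.
elim: n X d G e => // n IHn X d G e se e0 eS eJ aX.
have S := ses_nat_ker se.
have [q qE] : exists q : nattrans (X 1%N) (nat_ker e),
    forall x s, nat_ker_incl e x (q x s) = d 0%N x s.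
  by apply: (ses_factor S) => x s; apply/e0; exists s.
have qK x t : q x t = 0 <-> d 0%N x t = 0.
  split=> [t0|t0]; first by rewrite -qE t0 linear0.
  by apply: (nat_injP (ses_inj S)); rewrite qE t0 linear0.
apply: (acyclic_quot S) (aX 0%N _) => //.
- move=> x w wJ.
  have /e0[t tE] := ses_im S w.
  have := wJ; rewrite -tE => /eJ[r rJ].
  have -> : w = q x (t - d 1%N x r).
    apply: (nat_injP (ses_inj S)); rewrite qE linearB tE.
    by rewrite (_ : d 0%N x _ = 0) ?subr0 //; apply/eS; exists r.
  exact: J_nat.
- apply: (IHn (fun j => X j.+1) (fun j => d j.+1) _ q).
  + move=> x w; have /e0[t tE] := ses_im S w; exists t.
    by apply: (nat_injP (ses_inj S)); rewrite qE.
  + by move=> x t; apply: iff_trans (qK x t) _; apply: eS.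
  + by move=> j; apply: eS.
  + by move=> j; apply: eJ.
  + by move=> j jn; have := aX j.+1; rewrite subSS; apply.
Qed.

End Quotient.

Notation J_sub p G x := (span_sub (@J_gen _ _ _ p G x)).

(** * Acyclicity passes to directed unions *)

Section CoverMaps.
Variables (k : fieldType) (C : cat) (G' G : kfunctor k C) (u : nattrans G' G).

Lemma cover_nat (M N : kfunctor k C) (m : forall x, M x -> N x) :
  exists v : nattrans (cover M) N, forall x y (s : M x) (f : hom x y),
    v y << cgen s f >> = kmap N f (m x s).
Proof.
pose v y : {linear {malg k[cover_gen M y]} -> N y} :=
  free_lift (fun c : cover_gen M y => kmap N (projT2 c).2 (m _ (projT2 c).1)).
have v_nat y z (g : hom y z) (w : cover M y) :
    v z (kmap (cover M) g w) = kmap N g (v y w).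
  suff e1 : v z \o cover_map M g = kmap N g \o v y :> {linear _ -> _}.
    exact: (congr1 (fun h : {linear _ -> _} => h w) e1).
  by apply: free_ext => -[x [s f]]; rewrite /= !free_liftE /= kmapM.
exists (@Nattrans k C (cover M) N v v_nat) => x y s f.
by rewrite /= free_liftE.
Qed.

Lemma cover_ext (M N : kfunctor k C) (v w : nattrans (cover M) N) y t :
  (forall c : cover_gen M y, c \in msupp t -> v y << c >> = w y << c >>) ->
  v y t = w y t.
Proof.
move=> vw; rewrite (monalgE t) !linear_sum /= !big_seq; apply: eq_bigr => c ct.
by rewrite malgUZ !linearZ /= vw.
Qed.

Hypothesis iu : nat_inj u.

(** The free cover of a subfunctor is a direct summand of the free cover: the
    retraction kills the generators outside of the subfunctor. *)
Lemma cover_split : exists (c : nattrans (cover G') (cover G))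
    (r : nattrans (cover G) (cover G')),
  [/\ forall x t, r x (c x t) = t,
      forall x t, cover_aug G x (c x t) = u x (cover_aug G' x t)
    & forall x t, (forall g : cover_gen G x, g \in msupp t ->
                     exists s, u _ s = (projT2 g).1) -> c x (r x t) = t].
Proof.
have [c cE] := @cover_nat G' (cover G) (fun x s => << cgen (u x s) (idc x) >>).
have [r rE] := @cover_nat G (cover G') (fun x s =>
  if pselect (exists s', u x s' = s) is left h
  then << cgen (projT1 (cid h)) (idc x) >> else 0).
have cE' x y s (f : hom x y) : c y << cgen s f >> = << cgen (u x s) f >>.
  by rewrite cE /= free_liftE /= compc1.
have rE' x y s (f : hom x y) : r y << cgen (u x s) f >> = << cgen s f >>.
  rewrite rE; case: pselect => [h|]; last by case; exists s.
  rewrite /= free_liftE /= compc1; case: cid => /= s' /(nat_injP iu) -> //.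
exists c, r; split=> x t.
- have := @cover_ext G' (cover G') (nat_comp r c) (nat_id _) x t.
  by apply=> -[y [s f]] _ /=; rewrite cE' rE'.
- have := @cover_ext G' G (nat_comp (cover_aug G) c) (nat_comp u (cover_aug G')) x t.
  apply=> -[y [s f]] _; rewrite [LHS]/= [X in cover_aug_map _ _ X]cE'.
  by rewrite /= !free_liftE /= app_nat.
- move=> ht; have := @cover_ext G (cover G) (nat_comp c r) (nat_id _) x t.
  apply=> -[y [s f]] /ht /= [s' <-].
  by rewrite rE' cE'.
Qed.

End CoverMaps.

Section Local.
Variables (k : fieldType) (C D : cat) (p : functor C D).

(** An element of the cover of G involves finitely many elements of G, so it
    belongs to the cover of one of the subfunctors G', which is a direct summand;
    hence it lies in J there if it does in the cover of G.  The kernels of the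
    covers of the G' again exhaust the kernel of the cover of G. *)
Lemma acyclic_local n (G : kfunctor k C) :
  (forall l : seq {classic {x : C & G x}}, exists (G' : kfunctor k C)
     (u : nattrans G' G), [/\ nat_inj u, acyclic p n G' &
       forall g, g \in l -> exists s, u _ s = projT2 g]) ->
  acyclic p n G.
Proof.
elim: n G => // n IHn G hG.
pose gen_of x (c : cover_gen G x) : {classic {x : C & G x}} :=
  existT (fun x => G x : Type) (projT1 c) (projT2 c).1.
pose gens x (t : cover G x) : seq {classic {x : C & G x}} :=
  [seq gen_of x c | c <- msupp t].
exists (nat_ker (cover_aug G)), (cover G), (nat_ker_incl (cover_aug G)), (cover_aug G).
have S H := ses_nat_ker (@cover_aug_surj k C H).
have kmapP G' (u : nattrans G' G) (c : nattrans (cover G') (cover G)) :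
  (forall x t, cover_aug G x (c x t) = u x (cover_aug G' x t)) ->
  exists v : nattrans (nat_ker (cover_aug G')) (nat_ker (cover_aug G)),
    forall x s, nat_ker_incl _ x (v x s) = c x (nat_ker_incl _ x s).
  move=> ca; have [|v vE] := @ses_factor _ _ _ _ _ _ _ _
    (nat_comp c (nat_ker_incl (cover_aug G'))) (S G); last by exists v.
  by move=> x s; rewrite /= [LHS]ca (ses_im (S G')) linear0.
have gensP x (t : cover G x) (l : seq {classic {y : C & G y}}) (G' : kfunctor k C) (u : nattrans G' G) :
  {subset gens x t <= l} -> (forall g, g \in l -> exists s, u _ s = projT2 g) ->
  forall g : cover_gen G x, g \in msupp t -> exists s, u _ s = (projT2 g).1.
  by move=> sl hl g gt; apply: (hl (gen_of x g)); apply/sl/map_f.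
split=> //; first exact: cover_projective.
- move=> x w wJ.
  have [G' [u [iu aG' hu]]] := hG (gens x (nat_ker_incl _ x w)).
  have [c [r [rc ca cr]]] := cover_split iu.
  have [pG' _] := acyclic_syzygy aG' (@cover_projective k C G') (S G').
  have wE := cr x (nat_ker_incl _ x w) (gensP _ _ _ _ u (fun _ h => h) hu).
  have [w' w'E] : exists w', nat_ker_incl (cover_aug G') x w' = r x (nat_ker_incl _ x w).
    apply: (ses_ker (S G')); apply: iu.
    by rewrite -ca wE (ses_im (S G)).
  have [v vE] := kmapP _ _ _ ca.
  have -> : w = v x w' by apply: (nat_injP (ses_inj (S G))); rewrite vE w'E wE.
  by apply: J_nat; apply: pG'; rewrite w'E; apply: J_nat.
- apply: IHn => l.
  have [G' [u [iu aG' hu]]] := hG (flatten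
    [seq gens (projT1 g) (nat_ker_incl (cover_aug G) _ (projT2 g)) | g <- l]).
  have [c [r [rc ca cr]]] := cover_split iu.
  have [_ aK] := acyclic_syzygy aG' (@cover_projective k C G') (S G').
  have [v vE] := kmapP _ _ _ ca.
  exists (nat_ker (cover_aug G')), v; split=> //.
  + move=> x s s0; apply: (ses_inj (S G')).
    by rewrite -(rc x (nat_ker_incl _ x s)) -vE s0 !linear0.
  + move=> [x w] gl /=; set t := nat_ker_incl (cover_aug G) x w.
    have sl : {subset gens x t <= flatten [seq gens (projT1 g)
        (nat_ker_incl (cover_aug G) _ (projT2 g)) | g <- l]}.
      move=> h hg; apply/flattenP; exists (gens x t) => //.
      pose gen_t (g : {classic {y : C & nat_ker (cover_aug G) y}}) :=
        gens (projT1 g) (nat_ker_incl (cover_aug G) _ (projT2 g)).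
      exact: (map_f gen_t gl).
    have wE := cr x t (gensP x t _ G' u sl hu).
    have [w' w'E] : exists w', nat_ker_incl (cover_aug G') x w' = r x t.
      apply: (ses_ker (S G')); apply: iu.
      by rewrite -ca wE (ses_im (S G)).
    by exists w'; apply: (nat_injP (ses_inj (S G))); rewrite vE w'E wE.
Qed.

End Local.

(** * The bar complex of a translation action *)

Section FreeModules.
Variable k : fieldType.

(** Locked, since simplification would otherwise turn its applications into
    sums over supports. *)
Definition malg_map (S T : choiceType) (f : S -> T) :
  {linear {malg k[S]} -> {malg k[T]}} := locked (free_lift (fun s => << f s >>)).

Lemma malg_mapE (S T : choiceType) (f : S -> T) s : malg_map f << s >> = << f s >>.
Proof. by rewrite /malg_map -lock free_liftE. Qed.

Lemma malg_ind (S : choiceType) (Z : submodClosed {malg k[S]}) t :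
  (forall s, s \in msupp t -> << s >> \in Z) -> t \in Z.
Proof.
move=> h; rewrite (monalgE t) big_seq rpred_sum // => s st.
by rewrite malgUZ rpredZ // h.
Qed.

Lemma malg_eq (S : choiceType) (U : lmodType k) (f g : {linear {malg k[S]} -> U}) :
  (forall s, f << s >> = g << s >>) -> forall t, f t = g t.
Proof. by move=> fg t; rewrite (free_ext fg). Qed.

Lemma malg_map_surj (S T : choiceType) (f : S -> T) :
  (forall t, exists s, f s = t) -> forall v, exists u, malg_map f u = v.
Proof.
move=> fs v; suff : v \in im_sub (malg_map f) by move=> /asboolP.
apply: malg_ind => t _; have [s <-] := fs t.
by apply/asboolP; exists << s >>; rewrite malg_mapE.
Qed.

(** The kernel of k[S] -> k[T] is spanned by the differences of elements of S
    with the same image: modulo these, t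
    equals the linear combination of chosen preimages that corresponds to its
    image, which is 0. *)
Lemma malg_map_ker (S T : choiceType) (f : S -> T) (Z : submodClosed {malg k[S]}) :
  (forall s s', f s = f s' -> << s >> - << s' >> \in Z) ->
  forall t, malg_map f t = 0 -> t \in Z.
Proof.
move=> hZ t t0.
pose h (y : T) : {malg k[S]} :=
  if pselect (exists s, f s = y) is left e then << projT1 (cid e) >> else 0.
pose g : {linear {malg k[S]} -> {malg k[S]}} :=
  idfun \- (free_lift h \o malg_map f).
have <- : g t = t by rewrite /= t0 linear0 subr0.
suff : t \in preim_sub g Z by [].
apply: malg_ind => s _.
change (<< s >> - free_lift h (malg_map f << s >>) \in Z).
rewrite malg_mapE free_liftE /h; case: pselect => [e|]; last by case; exists s.
by apply: hZ; case: cid.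
Qed.

End FreeModules.

Section Bar.
Variable k : fieldType.
Implicit Types V X Y : lmodType int.

(** X x V^j, with the letter in X first.  The tail of a word is a bar word with
    V in place of X; this makes the boundary below a structural recursion over
    all X at once. *)
Fixpoint bar V X (j : nat) : lmodType int :=
  if j is j'.+1 then (X * bar V V j')%type else X.

Definition bar_hd V X j : bar V X j -> X :=
  match j return bar V X j -> X with 0 => fun x => x | _.+1 => fun y => y.1 end.

Definition bar_set V X X' j : bar V X j -> X' -> bar V X' j :=
  match j return bar V X j -> X' -> bar V X' j with
  | 0 => fun _ v => v | _.+1 => fun y v => (v, y.2) end.

(** The first face of the bar complex,
    (x; v_1, ..., v_j+1) |-> (x + phi v_1; v_2, ..., v_j+1). *)
Definition bar_act V X (phi : {linear V -> X}) j (x : X) (u : bar V V j) : bar V X j :=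
  bar_set u (x + phi (bar_hd u)).

(** The alternating sum of the faces.  All the faces but the first one keep x,
    and together they form the boundary of the tail, for the action of V on
    itself by translation. *)
Fixpoint bar_d V (j : nat) :
    forall X, {linear V -> X} -> {linear {malg k[bar V X j.+1]} -> {malg k[bar V X j]}} :=
  match j return forall X, {linear V -> X} ->
    {linear {malg k[bar V X j.+1]} -> {malg k[bar V X j]}} with
  | 0 => fun X phi => free_lift (fun y : bar V X 1 => << y.1 + phi y.2 >> - << y.1 >>)
  | j'.+1 => fun X phi => free_lift (fun y : bar V X j'.+2 =>
      << bar_act phi (j := j'.+1) y.1 y.2 >>
       - malg_map k (fun w : bar V V j' => (y.1, w) : bar V X j'.+1)
           (@bar_d V j' V idfun << y.2 >>))
  end.

Arguments bar_d {V} j {X} phi.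

(** The faces other than the first one, with the opposite sign.  In the lowest
    degree only the face that drops the last letter is left. *)
Definition bar_rest V X (j : nat) (x : X) :
    {linear {malg k[bar V V j]} -> {malg k[bar V X j]}} :=
  match j return {linear {malg k[bar V V j]} -> {malg k[bar V X j]}} with
  | 0 => free_lift (fun _ => << x >>)
  | j'.+1 => malg_map k (fun w : bar V V j' => (x, w) : bar V X j'.+1)
               \o @bar_d V j' V idfun
  end.

Arguments bar_rest {V X} j x.

Lemma bar_dE V j X (phi : {linear V -> X}) (x : X) (u : bar V V j) :
  bar_d j phi << ((x, u) : bar V X j.+1) >> =
  << bar_act phi x u >> - bar_rest j x << u >>.
Proof. by case: j u => [|j] u /=; rewrite !free_liftE. Qed.

Lemma bar_set_set V X X' X'' j (y : bar V X j) (v : X') (w : X'') :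
  bar_set (bar_set y v) w = bar_set y w.
Proof. by case: j y. Qed.

Lemma bar_hd_set V X X' j (y : bar V X j) (v : X') : bar_hd (bar_set y v) = v.
Proof. by case: j y. Qed.

Lemma bar_act_act V X (phi : {linear V -> X}) j (x : X) (v : V) (u : bar V V j) :
  bar_act phi x (bar_act idfun v u) = bar_act phi (x + phi v) u.
Proof. by rewrite /bar_act bar_set_set bar_hd_set linearD addrA. Qed.

Lemma bar_act_rest V X (phi : {linear V -> X}) j (x : X) (v : V) t :
  malg_map k (bar_act phi (j := j) x) (bar_rest j v t) = bar_rest j (x + phi v) t.
Proof.
case: j t => [|j] t.
  pose f := malg_map k (bar_act phi (j := 0) x).
  apply: (@malg_eq k _ _ (f \o bar_rest 0 v) (bar_rest 0 (x + phi v))) => s.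
  by rewrite /f /= !free_liftE malg_mapE.
rewrite /=; move: (bar_d j _ _) => w.
set f := malg_map k _; set g := malg_map k _; set h := malg_map k _.
by apply: (@malg_eq k _ _ (f \o g) h) => s; rewrite /= !malg_mapE.
Qed.

Lemma bar_d_pair V j X (phi : {linear V -> X}) (x : X) t :
  bar_d j phi (malg_map k (fun u : bar V V j => (x, u) : bar V X j.+1) t) =
  malg_map k (bar_act phi (j := j) x) t - bar_rest j x t.
Proof.
set f := malg_map k _; set g := malg_map k _.
apply: (@malg_eq k _ _ (bar_d j phi \o f) (g \- bar_rest j x)) => u.
by rewrite [LHS]/= malg_mapE bar_dE /= malg_mapE.
Qed.

(** The composites through the first face cancel by [bar_act_act] and
    [bar_act_rest]; what is left is the square of the boundary of the tail. *)
Lemma bar_dd_aux V j X (phi : {linear V -> X}) :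
  (forall (x : X) w, bar_rest j x (bar_d j (idfun : {linear V -> V}) w) = 0) ->
  forall t, bar_d j phi (bar_d j.+1 phi t) = 0.
Proof.
move=> rd; apply: (@malg_eq k _ _ (bar_d _ phi \o bar_d _ phi) \0) => -[x [v u]].
have e : bar_d j phi << bar_act phi (j := j.+1) x (v, u) >> =
    << bar_act phi (x + phi v) u >> - bar_rest j (x + phi v) << u >>.
  exact: bar_dE.
have e' : bar_rest j.+1 x << (v, u) : bar V V j.+1 >> = malg_map k
    (fun w : bar V V j => (x, w) : bar V X j.+1)
      (bar_d j idfun << (v, u) : bar V V j.+1 >>) by [].
change (bar_d j phi (bar_d j.+1 phi << (x, (v, u)) : bar V X j.+2 >>) = 0).
rewrite bar_dE linearB e e' bar_d_pair rd subr0 bar_dE linearB malg_mapE.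
by rewrite bar_act_act bar_act_rest subrr.
Qed.

Lemma bar_dd V j X (phi : {linear V -> X}) t :
  bar_d j phi (bar_d j.+1 phi t) = 0.
Proof.
elim: j X phi t => [|j IHj] X phi t.
  have rd (x : X) w : bar_rest 0 x (bar_d 0 (idfun : {linear V -> V}) w) = 0.
    apply: (@malg_eq k _ _ (bar_rest 0 x \o bar_d 0 idfun) \0) => -[v u].
    change (bar_rest 0 x (bar_d 0 idfun << (v, u) : bar V V 1 >>) = 0).
    by rewrite (bar_dE (j := 0)) linearB /= !free_liftE subrr.
  exact: bar_dd_aux.
apply: bar_dd_aux => x w; rewrite /= IHj linear0 //.
Qed.

Lemma coset_section V X (phi : {linear V -> X}) :
  exists (r : X -> X) (s : X -> V),
    (forall x, r x + phi (s x) = x) /\ (forall x v, r (x + phi v) = r x).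
Proof.
pose r x : X := repr (quot_pi (im_sub phi) x : Quotient.quot _).
have rP x : exists v, phi v = x - r x.
  have /rpredNr := quot_repr (im_sub phi) x; rewrite opprB.
  by move=> /asboolP.
exists r, (fun x => projT1 (cid (rP x))); split=> [x|x v].
  by case: cid => v /= ->; rewrite addrC subrK.
rewrite /r; congr (repr _); apply/quot_eqP; rewrite addrAC subrr add0r.
by apply/asboolP; exists v.
Qed.

Section Box.
Variables (V : lmodType int) (n : nat).

(** A multiset standing in for the subgroup generated by the list cs: when n > 0
    kills cs it maps onto this subgroup with fibres of constant size, and it has
    n ^ size cs elements, a number invertible in k if n is.  Unlike the subgroup
    it needs no enumeration, and sums over it are still invariant under
    translation by the elements of cs ([box_shift]). *)
Fixpoint box (cs : seq V) : seq V :=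
  if cs is c :: cs' then [seq h + c *+ i | i <- iota 0 n, h <- box cs'] else [:: 0].

Lemma size_box cs : size (box cs) = (n ^ size cs)%N.
Proof. by elim: cs => //= c cs IH; rewrite size_allpairs size_iota IH expnS. Qed.

Lemma box_sub cs (Z : submodClosed V) :
  (forall c, c \in cs -> c \in Z) -> forall h, h \in box cs -> h \in Z.
Proof.
elim: cs => [_ h|c cs IH cZ h] /=; first by rewrite inE => /eqP->; rewrite rpred0.
move=> /allpairsP[[i g] /= [_ gb ->]]; rewrite rpredD ?rpredMn ?(cZ c) ?mem_head //.
by apply: (IH _ _ gb) => d dcs; rewrite cZ // inE dcs orbT.
Qed.

Lemma box_shift cs c (U : zmodType) (F : V -> U) :
  c \in cs -> (forall d, d \in cs -> d *+ n = 0) ->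
  \sum_(h <- box cs) F (h + c) = \sum_(h <- box cs) F h.
Proof.
elim: cs F => // d cs IH F; rewrite inE => /orP[/eqP->|ccs] nt /=.
  rewrite !big_allpairs_dep exchange_big [RHS]exchange_big /=; apply: eq_bigr => h _.
  have -> : \sum_(i <- iota 0 n) F (h + d *+ i + d) =
      \sum_(i <- iota 0 n) F (h + d *+ i.+1).
    by apply: eq_bigr => i _; rewrite mulrSr addrA.
  have := nt d (mem_head _ _); case: n => [|m] dm; first by rewrite !big_nil.
  rewrite -[iota 0 m.+1]/(index_iota 0 m.+1) big_nat_recr // big_nat_recl //=.
  by rewrite dm mulr0n addrC.
rewrite !big_allpairs_dep; apply: eq_bigr => i _ /=.
rewrite -(IH (fun h => F (h + d *+ i))) //.
  by apply: eq_bigr => h _; rewrite addrAC.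
by move=> e ecs; apply: nt; rewrite inE ecs orbT.
Qed.

End Box.

(** The homology of the bar complex is that of the stabilizers of the action,
    here ker phi, whose finitely generated subgroups have order invertible in k.
    An explicit contraction S prepends to a word with first letter x the coset
    representative r x, and replaces x by s x + h, averaged over h in a box H
    inside ker phi.  Then dS + Sd = 1 on a word (x, u) as soon as H is invariant
    under cc (x, u), which measures the failure of s to be equivariant; given a
    cycle t, the box is built from the words in the support of t. *)
Lemma bar_exact V X (phi : {linear V -> X}) (n : nat) :
  n%:R != 0 :> k -> (forall v, phi v = 0 -> v *+ n = 0) ->
  forall j t, bar_d j phi t = 0 -> exists u, bar_d j.+1 phi u = t.
Proof.
move=> n0 kern j t t0.
have [r [s [rs rphi]]] := coset_section phi.
have phis x : phi (s x) = x - r x by rewrite -[X in X - _]rs addrAC subrr add0r.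
pose cc (y : bar V X j.+1) : V :=
  s y.1 + bar_hd y.2 - s (y.1 + phi (bar_hd y.2)).
have cc0 y : phi (cc y) = 0.
  by rewrite linearB linearD !phis rphi [X in X - _]addrAC subrr.
set cs := [seq cc y | y <- msupp t].
have csP c : c \in cs -> phi c = 0 by move=> /mapP[y _ ->].
pose H := box n cs; pose N : k := (size H)%:R.
have N0 : N != 0 by rewrite /N size_box natrX expf_neq0.
have H0 h : h \in H -> phi h = 0.
  move=> hH; apply/eqP; apply: (box_sub (Z := ker_sub phi)) hH => c /csP c0.
  by rewrite inE c0.
pose av (U : lmodType k) (f : V -> U) : U := N^-1 *: \sum_(h <- H) f h.
have avl (U W : lmodType k) (g : {linear U -> W}) f : g (av U f) = av W (fun h => g (f h)).
  by rewrite linearZ linear_sum.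
have avc (U : lmodType k) (c : U) : av U (fun=> c) = c.
  by rewrite /av big_const_seq count_predT iter_addr_0 -scaler_nat scalerA mulVf ?scale1r.
have avB (U : lmodType k) f g : av U (fun h => f h - g h) = av U f - av U g.
  by rewrite /av sumrB scalerBr.
have eq_av (U : lmodType k) f g : (forall h, h \in H -> f h = g h) -> av U f = av U g.
  by move=> fg; rewrite /av !big_seq (eq_bigr g).
have avlin (U W : lmodType k) (f : V -> {linear U -> W}) :
    linear (fun u => av W (fun h => f h u)).
  move=> a u v; rewrite /av scalerA mulrC -scalerA -scalerDr; congr (_ *: _).
  rewrite scaler_sumr -big_split; apply: eq_bigr => h _; exact: linearP.
pose S i : {linear {malg k[bar V X i]} -> {malg k[bar V X i.+1]}} :=
  free_lift (fun y => av _ (fun h =>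
    << (r (bar_hd y), bar_set y (s (bar_hd y) + h)) : bar V X i.+1 >>)).
pose pr i x : {linear {malg k[bar V V i]} -> {malg k[bar V X i.+1]}} :=
  malg_map k (fun w : bar V V i => (x, w) : bar V X i.+1).
have prE i x w : pr i x << w >> = << (x, w) : bar V X i.+1 >> by exact: malg_mapE.
have S_rest i x w : S i (bar_rest i x w) =
    pr i (r x) (av _ (fun h => bar_rest i (s x + h) w)).
  case: i w => [|i] w.
    apply: (@malg_eq k _ _ (S 0 \o bar_rest 0 x) (pr 0 (r x) \o
      lin_of (avlin _ _ (fun h => bar_rest 0 (s x + h))))) => y.
    by rewrite /= !free_liftE /= avl; apply: eq_av => h _; rewrite free_liftE prE.
  change (S i.+1 (pr i x (bar_d i idfun w)) = pr i.+1 (r x) (av _ (fun h =>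
    malg_map k (fun w : bar V V i => (s x + h, w) : bar V V i.+1) (bar_d i idfun w)))).
  move: (bar_d i _ w) => {}w.
  apply: (@malg_eq k _ _ (S i.+1 \o pr i x) (pr i.+1 (r x) \o lin_of (avlin _ _ (fun h =>
    malg_map k (fun w : bar V V i => (s x + h, w) : bar V V i.+1))))) => y.
  change (S i.+1 (pr i x << y >>) = pr i.+1 (r x) (av _ (fun h =>
    malg_map k (fun w : bar V V i => (s x + h, w) : bar V V i.+1) << y >>))).
  by rewrite prE free_liftE avl; apply: eq_av => h _; rewrite malg_mapE prE.
pose g : {linear {malg k[bar V X j.+1]} -> {malg k[bar V X j.+1]}} :=
  idfun \- (bar_d j.+1 phi \o S j.+1) \- (S j \o bar_d j phi).
suff : t \in ker_sub g.
  change (t - bar_d j.+1 phi (S j.+1 t) - S j (bar_d j phi t) == 0 -> 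
    exists u, bar_d j.+1 phi u = t).
  by rewrite t0 linear0 subr0 subr_eq0 => /eqP tE; exists (S j.+1 t).
apply: malg_ind => -[x u] yt; rewrite inE; apply/eqP.
change (<< (x, u) : bar V X j.+1 >> - bar_d j.+1 phi (S j.+1 << (x, u) : bar V X j.+1 >>)
  - S j (bar_d j phi << (x, u) : bar V X j.+1 >>) = 0).
rewrite bar_dE linearB S_rest {1}/S free_liftE avl.
have -> : av _ (fun h => bar_d j.+1 phi << (r x, (s x + h, u)) : bar V X j.+2 >>) =
   << (x, u) : bar V X j.+1 >> - pr j (r x) (av _ (fun h => << bar_act idfun (s x + h) u >>))
     + pr j (r x) (av _ (fun h => bar_rest j (s x + h) << u >>)).
  rewrite -[X in X - _ + _](avc _ << (x, u) : bar V X j.+1 >>) !(avl _ _ (pr j (r x))).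
  rewrite -addrA [X in _ + X]addrC -opprB -avB -avB; apply: eq_av => h hH.
  rewrite bar_dE {1}/bar_act /= linearD (H0 h hH) addr0 rs.
  by rewrite -/(pr j (r x)) bar_dE linearB.
have -> : S j << bar_act phi x u >> =
    pr j (r x) (av _ (fun h => << bar_act idfun (s x + h) u >>)).
  rewrite free_liftE /bar_act bar_hd_set rphi avl /av; congr (_ *: _).
  transitivity (\sum_(h <- H) pr j (r x)
    << bar_set u (s (x + phi (bar_hd u)) + h) : bar V V j >>).
    by apply: eq_bigr => h _; rewrite prE bar_set_set.
  rewrite -(@box_shift V n cs (cc (x, u))).
  - apply: eq_bigr => h _; rewrite /bar_act /cc /=; congr (pr _ _ << bar_set u _ >>).
    by rewrite addrCA [X in h + X]addrC subrK addrCA addrA.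
  - exact: (map_f cc).
  - by move=> c /csP /kern.
set aa := << _ >>; set A := pr _ _ _; set B := pr _ _ _.
by rewrite -[aa - A + B]addrA [- A + B]addrC opprD addrA subrr add0r opprB subrr.
Qed.

Fixpoint bar_fun V V' (g : V -> V') (j : nat) : forall X X', (X -> X') ->
    bar V X j -> bar V' X' j :=
  match j return forall X X', (X -> X') -> bar V X j -> bar V' X' j with
  | 0 => fun X X' q => q
  | j'.+1 => fun X X' q y => (q y.1, @bar_fun V V' g j' V V' g y.2)
  end.
Arguments bar_fun {V V'} g j {X X'} q.

Lemma bar_fun_linear V V' X X' (g : {linear V -> V'}) (q : {linear X -> X'}) j :
  linear (bar_fun g j q).
Proof.
elim: j X X' q => [|j IHj] X X' q a u v /=; first exact: linearP.
by rewrite linearP IHj.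
Qed.

Lemma bar_fun0 V V' X X' (g : {linear V -> V'}) (q : {linear X -> X'}) j :
  bar_fun g j q 0 = 0.
Proof. exact: (linear0 (lin_of (@bar_fun_linear _ _ _ _ g q j))). Qed.

Lemma bar_fun_surj V V' X X' (g : V -> V') (q : X -> X') j :
  (forall v, exists w, g w = v) -> (forall x, exists y, q y = x) ->
  forall t, exists s, bar_fun g j q s = t.
Proof.
move=> gs; elim: j X X' q => [|j IHj] X X' q qs //= -[x t].
by have [y <-] := qs x; have [s <-] := IHj _ _ _ gs t; exists (y, s).
Qed.

Lemma bar_fun_act V V' X X' (phi : {linear V -> X}) (phi' : {linear V' -> X'})
    (g : {linear V -> V'}) (q : {linear X -> X'}) j x u :
  (forall v, q (phi v) = phi' (g v)) ->
  bar_fun g j q (bar_act phi x u) = bar_act phi' (q x) (bar_fun g j g u).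
Proof.
by move=> h; rewrite /bar_act; case: j u => [|j] u /=; rewrite linearD h.
Qed.

Lemma bar_d_nat V V' X X' (phi : {linear V -> X}) (phi' : {linear V' -> X'})
    (g : {linear V -> V'}) (q : {linear X -> X'}) j t :
  (forall v, q (phi v) = phi' (g v)) ->
  bar_d j phi' (malg_map k (bar_fun g j.+1 q) t) =
  malg_map k (bar_fun g j q) (bar_d j phi t).
Proof.
have step i (Y Y' : lmodType int) (f : {linear V -> Y}) (f' : {linear V' -> Y'})
    (r : {linear Y -> Y'}) s : (forall v, r (f v) = f' (g v)) ->
    (forall x w, malg_map k (bar_fun g i r) (bar_rest i x w) =
                 bar_rest i (r x) (malg_map k (bar_fun g i g) w)) ->
    bar_d i f' (malg_map k (bar_fun g i.+1 r) s) =
    malg_map k (bar_fun g i r) (bar_d i f s).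
  move=> h rd; set m := malg_map k _; set m' := malg_map k _.
  apply: (@malg_eq k _ _ (bar_d i f' \o m) (m' \o bar_d i f)) => -[x u].
  change (bar_d i f' (m << (x, u) : bar V Y i.+1 >>) =
    m' (bar_d i f << (x, u) : bar V Y i.+1 >>)).
  have := rd x << u >>; rewrite malg_mapE => rdu.
  rewrite /m malg_mapE [bar_fun _ _ _ _]/= bar_dE -rdu bar_dE linearB -/m'.
  by rewrite [m' << _ >>]malg_mapE (bar_fun_act _ _ h).
elim: j X X' phi phi' q t => [|j IHj] X X' phi phi' q t h.
  apply: step => // x w; set m := malg_map k _; set m' := malg_map k _.
  apply: (@malg_eq k _ _ (m \o bar_rest 0 x) (bar_rest 0 (q x) \o m')) => u.
  by rewrite /m /m' /= malg_mapE !free_liftE malg_mapE.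
apply: step => // x w.
pose m1 := malg_map k (bar_fun g j.+1 q).
pose m2 := malg_map k (fun u : bar V V j => (x, u) : bar V X j.+1).
pose m3 := malg_map k (fun u : bar V' V' j => (q x, u) : bar V' X' j.+1).
pose m4 := malg_map k (bar_fun g j g).
change (m1 (m2 (bar_d j idfun w)) =
  m3 (bar_d j idfun (malg_map k (bar_fun g j.+1 g) w))).
rewrite (IHj V V' idfun idfun g w) // -/m4; move: (bar_d j _ w) => {}w.
apply: (@malg_eq k _ _ (m1 \o m2) (m3 \o m4)) => u.
by rewrite /m1 /m2 /m3 /m4 /= !malg_mapE.
Qed.

End Bar.
Arguments bar_fun {V V'} g j {X X'} q.
Arguments bar_d {k V} j {X} phi.
Arguments bar_rest {k V X} j x.

(** * Additive functors and their linearizations *)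

Lemma additive_linear (U V : lmodType int) (f : U -> V) :
  {morph f : u v / u + v} -> linear f.
Proof.
move=> fD; pose g : {additive U -> V} := HB.pack f (GRing.isZmodMorphism.Build U V f
  (fun u v => let e : f u = f (u - v) + f v := 
     etrans (congr1 f (esym (subrK v u))) (fD _ _) in
     etrans (esym (addrK (f v) (f (u - v)))) (congr1 (fun w => w - f v) (esym e)))).
move=> a u v; rewrite fD; congr (_ + _).
have sz (W : lmodType int) (w : W) : a *: w = w *~ a by rewrite -[a in LHS]intz scaler_int.
by rewrite !sz; exact: (raddfMz g).
Qed.

(** Abelian groups are encoded as modules over int, so that submodules and
    quotients of modules apply to them. *)
Record addfun (A : addcat) := AddFun {
  aob :> A -> lmodType int;
  amap : forall x y : A, hom x y -> {linear aob x -> aob y};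
  amap1 : forall x (m : aob x), amap (idc x) m = m;
  amapM : forall (x y z : A) (g : hom y z) (f : hom x y) (m : aob x),
    amap (compc g f) m = amap g (amap f m);
  amapD : forall (x y : A) (f g : ahom x y) (m : aob x),
    amap (f + g : ahom x y) m = amap f m + amap g m }.
Arguments amap {A} M {x y} f : rename.

Section AdditiveFunctors.
Variable A : addcat.

Definition acomp_l (x y z : A) (g : ahom y z) (f : zmodule (ahom x y)) :
  zmodule (ahom x z) := acomp g f.
Fact acomp_l_linear x y z g : linear (@acomp_l x y z g).
Proof. by apply: additive_linear => u v; exact: acompDr. Qed.

Definition rep (x : A) : addfun A.
Proof.
refine (@AddFun A (fun y => zmodule (ahom x y))
  (fun y z g => lin_of (@acomp_l_linear x y z g)) _ _ _).
- by move=> y f; exact: acomp1c.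
- by move=> y z t h g f; exact/esym/acompA.
- by move=> y z f g h; exact: acompDl.
Defined.

Variable M : addfun A.

Lemma amapB (x y : A) (f g : ahom x y) (m : M x) :
  amap M (f - g : ahom x y) m = amap M f m - amap M g m.
Proof. by apply/eqP; rewrite -subr_eq opprK -amapD subrK. Qed.

Lemma amap0 (x y : A) (m : M x) : amap M (0 : ahom x y) m = 0.
Proof. by rewrite -(subrr (0 : ahom x y)) amapB subrr. Qed.

Lemma amapMn (x y : A) (f : ahom x y) (m : M x) n :
  amap M (f *+ n : ahom x y) m = amap M f m *+ n.
Proof. by elim: n => [|n IH]; rewrite ?mulr0n ?amap0 // !mulrS amapD IH. Qed.

Section Generated.
Variables (x : A) (m : M x).

Definition ev (y : A) (f : rep x y) : M y := amap M f m.
Fact ev_linear y : linear (@ev y).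
Proof. by apply: additive_linear => f g; exact: amapD. Qed.
Definition evl y : {linear rep x y -> M y} := lin_of (@ev_linear y).

Lemma evl_nat y z (g : hom y z) f : evl z (amap (rep x) g f) = amap M g (evl y f).
Proof. exact: amapM. Qed.

Fact cyclic_subproof y z (g : hom y z) s :
  s \in im_sub (evl y) -> amap M g s \in im_sub (evl z).
Proof.
move=> /asboolP[f <-]; apply/asboolP; exists (amap (rep x) g f).
by rewrite evl_nat.
Qed.

Definition cyclic_sub : addfun A.
Proof.
refine (@AddFun A (fun y => sub_of (im_sub (evl y)))
  (fun y z g => sub_map (@cyclic_subproof y z g)) _ _ _).
- by move=> y s; apply: val_inj; exact: amap1.
- by move=> y z t g f s; apply: val_inj; exact: amapM.
- by move=> y z f g s; apply: val_inj; exact: amapD.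
Defined.

Fact relations_subproof y z (g : hom y z) s :
  s \in ker_sub (evl y) -> amap (rep x) g s \in ker_sub (evl z).
Proof. by rewrite !inE evl_nat => /eqP->; rewrite linear0. Qed.

Definition relations : addfun A.
Proof.
refine (@AddFun A (fun y => sub_of (ker_sub (evl y)))
  (fun y z g => sub_map (@relations_subproof y z g)) _ _ _).
- by move=> y s; apply: val_inj; exact: (@amap1 A (rep x)).
- by move=> y z t g f s; apply: val_inj; exact: (@amapM A (rep x)).
- by move=> y z f g s; apply: val_inj; exact: (@amapD A (rep x)).
Defined.

End Generated.

(** The components of an element of M on a direct sum are its images under the
    projections; this is why finitely generated additive functors are cyclic. *)
Lemma generated_by_one (l : seq {classic {z : A & M z}}) :
  exists x (m : M x), forall g, g \in l -> exists f : hom x (projT1 g), amap M f m = projT2 g.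
Proof.
elim: l => [|[z s] l [x [m IH]]].
  by have [z _] := azero A; exists z, 0.
have [t [i1 [i2 [p1 [p2 [e11 e22 e12 e21 _]]]]]] := abiprod x z.
exists t, (amap M (i1 : @hom A x t) m + amap M (i2 : @hom A z t) s) => g.
rewrite inE => /orP[/eqP->|/IH[f fE]].
  exists p2; rewrite linearD /= -!amapM /=.
  by rewrite [acomp p2 i1]e21 [acomp p2 i2]e22 amap0 add0r [LHS]amap1.
exists (compc f (p1 : @hom A t x)); rewrite amapM linearD -!amapM /=.
by rewrite e11 e12 amap0 addr0 [amap M _ m]amap1.
Qed.

End AdditiveFunctors.

Definition rep_pull (A B : addcat) (p : functor A B) (pD : additive_functor p) (b : B) :
  addfun A.
Proof.
refine (@AddFun A (fun y => rep b (p y)) (fun y z g => amap (rep b) (fmor p g)) _ _ _).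
- by move=> y f; rewrite fmor1 amap1.
- by move=> y z t h g f; rewrite fmorM amapM.
- by move=> y z f g h; rewrite pD amapD.
Defined.


Definition bar_addfun (A : addcat) (X N : addfun A) (j : nat) : addfun A.
Proof.
refine (@AddFun A (fun z => bar (N z) (X z) j)
  (fun y z f => lin_of (@bar_fun_linear _ _ _ _ (amap N f) (amap X f) j)) _ _ _).
- move=> x m /=; elim: j X m => [|j IH] X m /=; first exact: amap1.
  by rewrite amap1 IH; case: m.
- move=> x y z g f m /=; elim: j X m => [|j IH] X m /=; first exact: amapM.
  by rewrite amapM IH.
- move=> x y f g m /=; elim: j X m => [|j IH] X m /=; first exact: amapD.
  by rewrite amapD IH.
Defined.

Section Linearization.
Variables (k : fieldType) (A : addcat).

Definition kfree (M : addfun A) : kfunctor k A.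
Proof.
refine (@KFunctor k A (fun x => {malg k[M x]}) (fun x y f => malg_map k (amap M f)) _ _).
- move=> x v; apply: (@malg_eq k _ _ (malg_map k (amap M (idc x))) idfun) => m.
  by rewrite malg_mapE amap1.
- move=> x y z g f v.
  apply: (@malg_eq k _ _ (malg_map k (amap M (compc g f)))
    (malg_map k (amap M g) \o malg_map k (amap M f))) => m.
  by rewrite /= !malg_mapE amapM.
Defined.

Definition kfree_nat (M N : addfun A) (u : forall x, M x -> N x)
  (nu : forall x y (f : hom x y) m, u y (amap M f m) = amap N f (u x m)) :
  nattrans (kfree M) (kfree N).
Proof.
refine (@Nattrans k A (kfree M) (kfree N) (fun x => malg_map k (u x)) _) => x y f v.
apply: (@malg_eq k _ _ (malg_map k (u y) \o malg_map k (amap M f))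
  (malg_map k (amap N f) \o malg_map k (u x))) => m.
by rewrite /= !malg_mapE nu.
Defined.

Lemma rep_yoneda (G : kfunctor k A) x (s : G x) :
  exists u : nattrans (kfree (rep x)) G,
    forall y (f : rep x y), u y << f >> = kmap G (f : hom x y) s.
Proof.
pose u y : {linear {malg k[rep x y]} -> G y} := free_lift (fun f => kmap G (f : hom x y) s).
have nu y z (g : hom y z) v : u z (kmap (kfree (rep x)) g v) = kmap G g (u y v).
  apply: (@malg_eq k _ _ (u z \o kmap (kfree (rep x)) g) (kmap G g \o u y)) => f.
  by rewrite /= malg_mapE !free_liftE -kmapM.
by exists (@Nattrans k A (kfree (rep x)) G u nu) => y f; exact: free_liftE.
Qed.

Lemma rep_projective x : projective (kfree (rep x)).
Proof.
move=> M N e u se.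
have [m mE] := se x (u x << (idc x : rep x x) >>).
have [v vE] := rep_yoneda m.
exists v; apply: nattrans_ext => y t.
apply: (@malg_eq k _ _ (e y \o v y) (u y)) => f.
rewrite /= vE app_nat mE -app_nat /= malg_mapE.
by congr (u y << _ >>); exact: acompc1.
Qed.

End Linearization.

(** * Linearizations of additive functors are acyclic *)

Section Linearizations.
Variables (k : fieldType) (A : addcat) (D : cat) (p : functor A D).
Implicit Types M N X : addfun A.

Hypothesis pD : forall (x y : A) (f f' g : ahom x y),
  fmor p f = fmor p f' -> fmor p (f + g : ahom x y) = fmor p (f' + g : ahom x y).
Hypothesis ptors : forall x : A, exists2 n : nat, n%:R != 0 :> k &
  fmor p (aid x *+ n : ahom x x) = fmor p (0 : ahom x x).

(** The elements of I M (x), the kernel of M -> p_! M for the additive version of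
    p_!; they already form a subgroup ([I_single]). *)
Definition I_gen M (x : A) (m : M x) : Prop :=
  exists z (f : ahom z x) (s : M z), fmor p f = fmor p (0 : ahom z x) /\ m = amap M f s.

Notation I M x := (span_sub (@I_gen M x)).

Lemma fmor0l (x y z : A) (f : hom y z) (g : hom x y) :
  fmor p f = fmor p (0 : ahom y z) -> fmor p (compc f g) = fmor p (0 : ahom x z).
Proof.
move=> f0; rewrite fmorM f0 -fmorM; congr fmor.
by apply: (@addrI _ (acomp 0 g)); rewrite addr0 -acompDl addr0.
Qed.

Lemma fmor0D (x y : A) (f g : ahom x y) :
  fmor p f = fmor p (0 : ahom x y) -> fmor p (f + g : ahom x y) = fmor p g.
Proof. by move=> f0; rewrite (pD _ f0) add0r. Qed.

Lemma I_in M (z x : A) (f : hom z x) (s : M z) :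
  fmor p f = fmor p (0 : ahom z x) -> amap M f s \in I M x.
Proof. by move=> f0; apply: span_sub_in; exists z, f, s. Qed.

Lemma I_B M (z x : A) (f g : hom z x) (s : M z) :
  fmor p f = fmor p g -> amap M f s - amap M g s \in I M x.
Proof.
move=> fg; rewrite -amapB; apply: I_in.
by rewrite (pD _ fg) subrr.
Qed.

(** f1 s1 + f2 s2 is the value of the matrix (f1, f2) at (s1, s2). *)
Lemma I_single M (x : A) (m : M x) : m \in I M x -> I_gen m.
Proof.
pose Q : {pred M x} := [pred m | `[< I_gen m >]].
have Q_closed : submod_closed Q.
  split=> [|a u v].
    by apply/asboolP; exists x, 0, 0; rewrite linear0.
  move=> /asboolP[z1 [f1 [s1 [f10 ->]]]] /asboolP[z2 [f2 [s2 [f20 ->]]]].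
  have [t [i1 [i2 [p1 [p2 [e11 e22 e12 e21 _]]]]]] := abiprod z1 z2.
  apply/asboolP; exists t, (acomp f1 p1 + acomp f2 p2).
  exists (amap M (i1 : @hom A z1 t) (a *: s1) + amap M (i2 : @hom A z2 t) s2).
  split.
    rewrite fmor0D; first exact: (fmor0l (p2 : @hom A t z2) f20).
    exact: (fmor0l (p1 : @hom A t z1) f10).
  rewrite amapD (amapM (f1 : @hom A z1 x) (p1 : @hom A t z1)).
  rewrite (amapM (f2 : @hom A z2 x) (p2 : @hom A t z2)) !(linearD (amap M _)) /=.
  rewrite -!(amapM (p1 : @hom A t z1)) -!(amapM (p2 : @hom A t z2)) /=.
  rewrite e11 e12 e21 e22 !amap0 !linear0 addr0 add0r.
  by rewrite ![amap M (aid _) _]amap1 linearZ.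
pose S : submodClosed (M x) := HB.pack Q (GRing.isSubmodClosed.Build _ _ Q Q_closed).
move=> /asboolP /(_ S) h; suff : m \in S by move=> /asboolP.
by apply: h => e ge; apply/asboolP.
Qed.

(** If m = m' + f s with p f = p 0, then m and m' are the images of the element
    (m', s) of M on x + z under (1, f) and (1, 0), which p identifies. *)
Lemma J_kfree M x (m m' : M x) : m - m' \in I M x ->
  << m >> - << m' >> \in J_sub p (kfree k M) x.
Proof.
move=> /I_single[z [f [s [f0 mE]]]].
have [t [i1 [i2 [p1 [p2 [e11 e22 e12 e21 _]]]]]] := abiprod x z.
pose w := amap M (i1 : @hom A x t) m' + amap M (i2 : @hom A z t) s.
have w1 : amap M (p1 : @hom A t x) w = m'.
  by rewrite linearD -!amapM /= e11 e12 amap0 addr0 [LHS]amap1.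
have w2 : amap M (p2 : @hom A t z) w = s.
  by rewrite linearD -!amapM /= e22 e21 amap0 add0r [LHS]amap1.
have -> : << m >> - << m' >> =
    kmap (kfree k M) (acomp f p2 + p1 : @hom A t x) << w >> -
    kmap (kfree k M) (p1 : @hom A t x) << w >>.
  rewrite /= !malg_mapE w1 amapD w1 [amap M (acomp f p2) w](amapM f (p2 : @hom A t z)).
  by rewrite w2 -mE subrK.
by apply: J_in; rewrite fmor0D //; exact: (fmor0l (p2 : @hom A t z) f0).
Qed.

Notation qI M x := (quot_pi (I M x)).

(** I commutes with products of additive functors, hence with bar words. *)
Lemma I_bar X N j (x : A) (m m' : bar_addfun X N j x) :
  bar_fun (qI N x) j (qI X x) m = bar_fun (qI N x) j (qI X x) m' ->
  m - m' \in I (bar_addfun X N j) x.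
Proof.
elim: j X m m' => [|j IHj] X m m' /=.
  move=> /quot_eqP /I_single[z [f [s [f0 ->]]]].
  exact: (@I_in (bar_addfun X N 0) z x f s f0).
case: m m' => [y u] [y' u'] /= [/quot_eqP /I_single[z [f [s [f0 yE]]]]].
move=> /IHj /I_single[z' [f' [s' [f'0 uE]]]].
have -> : (y, u) - (y', u') = (y - y', 0) + (0, u - u') :> bar_addfun X N j.+1 x.
  by congr (_, _); rewrite /= ?addr0 ?add0r.
rewrite rpredD // ?yE ?uE.
- have := @I_in (bar_addfun X N j.+1) z x f (s, 0) f0.
  by rewrite /= bar_fun0.
- have := @I_in (bar_addfun X N j.+1) z' x f' (0, s') f'0.
  by rewrite /= linear0.
Qed.

(** p_! takes the bar complex of N acting on X to that of N / I N acting on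
    X / I X. *)
Lemma J_bar X N j (x : A) (t : kfree k (bar_addfun X N j) x) :
  (t \in J_sub p (kfree k (bar_addfun X N j)) x) <->
  malg_map k (bar_fun (qI N x) j (qI X x)) t = 0.
Proof.
split; last first.
  by apply: malg_map_ker => m m' /I_bar /J_kfree.
set f := malg_map k _ => tJ; apply/eqP; suff : t \in ker_sub f by [].
move: t tJ; apply: J_min => _ [z [g [h [s [gh ->]]]]].
rewrite inE linearB subr_eq0; apply/eqP.
pose F := kfree k (bar_addfun X N j).
apply: (@malg_eq k _ _ (f \o kmap F g) (f \o kmap F h)) => m.
rewrite /f /= !malg_mapE; congr << _ >>.
elim: j X m {f F s} => [|j IHj] X m /=; first exact/quot_eqP/I_B.
by rewrite IHj; congr (_, _); apply/quot_eqP/I_B.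
Qed.

Section Cyclic.
Variables (M : addfun A) (x : A) (m : M x).

Let N := relations m.
Definition incl_rel (z : A) : {linear N z -> rep x z} :=
  (val : {linear sub_of (ker_sub (evl m z)) -> rep x z}).

Definition bar_cplx (j : nat) : kfunctor k A := kfree k (bar_addfun (rep x) N j).

Definition bar_diff (j : nat) : nattrans (bar_cplx j.+1) (bar_cplx j).
Proof.
refine (@Nattrans k A (bar_cplx j.+1) (bar_cplx j)
  (fun z => bar_d j (incl_rel z)) _) => y z f v.
by apply: (bar_d_nat (g := amap N f) (q := amap (rep x) f)).
Defined.

Fact evl_im (z : A) (f : rep x z) : evl m z f \in im_sub (evl m z).
Proof. by apply/asboolP; exists f. Qed.

Definition bar_aug : nattrans (bar_cplx 0) (kfree k (cyclic_sub m)).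
Proof.
refine (@kfree_nat k A (bar_addfun (rep x) N 0) (cyclic_sub m)
  (fun z (f : rep x z) => SubOf (evl_im f) : cyclic_sub m z) _).
by move=> y z f g; apply: val_inj; exact: evl_nat.
Defined.

Lemma bar_cplx0_projective : projective (bar_cplx 0).
Proof.
pose i : nattrans (bar_cplx 0) (kfree k (rep x)) :=
  @Nattrans k A (bar_cplx 0) (kfree k (rep x)) (fun z => idfun) (fun _ _ _ _ => erefl).
pose r : nattrans (kfree k (rep x)) (bar_cplx 0) :=
  @Nattrans k A (kfree k (rep x)) (bar_cplx 0) (fun z => idfun) (fun _ _ _ _ => erefl).
exact: (projective_retract (i := i) (r := r) _ (@rep_projective k A x)).
Qed.

Lemma bar_aug_surj : nat_surj bar_aug.
Proof.
move=> z; apply: malg_map_surj => -[s sm].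
have [f fE] := asboolP _ sm.
by exists f; apply: val_inj.
Qed.

Lemma bar_exact0 z t : bar_aug z t = 0 <-> exists r, bar_diff 0 z r = t.
Proof.
split=> [t0|[r <-]]; last first.
  apply: (@malg_eq k _ _ (bar_aug z \o bar_diff 0 z) \0) => -[f [g gN]].
  rewrite /= free_liftE linearB /= !malg_mapE.
  apply/eqP; rewrite subr_eq0; apply/eqP; congr << _ >>; apply: val_inj.
  change (evl m z (f + g) = evl m z f).
  by rewrite linearD (eqP gN) addr0.
suff : t \in im_sub (bar_diff 0 z) by move=> /asboolP.
apply: malg_map_ker t0 => f f' /(congr1 val) /= ff'; apply/asboolP.
have gN : f - f' \in ker_sub (evl m z).
  by rewrite inE linearB subr_eq0; apply/eqP.
exists << (f', SubOf gN) : bar (N z) (rep x z) 1 >>.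
by rewrite /= free_liftE /= (addrC f') subrK.
Qed.

Lemma bar_exactS j z t : bar_diff j z t = 0 <-> exists r, bar_diff j.+1 z r = t.
Proof.
split=> [t0|[r <-]]; last exact: bar_dd.
apply: (@bar_exact k _ _ (incl_rel z) 1) t0; first by rewrite oner_eq0.
by move=> v v0; rewrite mulr1n; apply: val_inj.
Qed.

(** Exactness of the bar complex of N / I N acting on A(x, -) / I A(x, -): the
    group N / I N has exponent n because n times the identity of z is congruent
    to 0. *)
Lemma bar_exactJ j z t : bar_diff j z t \in J_sub p (bar_cplx j) z ->
  exists r, t - bar_diff j.+1 z r \in J_sub p (bar_cplx j.+1) z.
Proof.
move=> /J_bar t0.
pose qN := qI N z; pose qX := qI (rep x) z.
have iI (v : N z) : v \in I N z -> (qX \o incl_rel z) v = 0.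
  move=> /I_single[y [f [s [f0 ->]]]]; rewrite -(linear0 qX).
  apply/quot_eqP; rewrite subr0.
  exact: (@I_in (rep x) y z f (incl_rel y s) f0).
pose phi : {linear quot_of (I N z) -> quot_of (I (rep x) z)} := quot_lift iI.
have h v : qX (incl_rel z v) = phi (qN v) by rewrite /phi quot_liftE.
have [n n0 nz] := ptors z.
have ntors w : phi w = 0 -> w *+ n = 0.
  move=> _; rewrite -(quot_piP w) -linearMn -(linear0 qN).
  apply/quot_eqP; rewrite subr0 -[X in X *+ n]amap1 -amapMn.
  exact: I_in.
have [r rE] : exists r, bar_d j.+1 phi r = malg_map k (bar_fun qN j.+1 qX) t.
  apply: (bar_exact n0 ntors); rewrite (bar_d_nat _ h) //.
have [w wE] : exists w, malg_map k (bar_fun qN j.+2 qX) w = r.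
  apply: malg_map_surj; apply: bar_fun_surj => v.
    by exists (repr (v : Quotient.quot _)); exact: quot_piP.
  by exists (repr (v : Quotient.quot _)); exact: quot_piP.
exists w; apply/J_bar; rewrite linearB; apply/eqP; rewrite subr_eq0; apply/eqP.
rewrite -rE -wE; exact: (bar_d_nat w h).
Qed.

End Cyclic.

Lemma malg_map_inj (S T : choiceType) (f : S -> T) t :
  injective f -> malg_map k f t = 0 -> t = 0.
Proof.
move=> fi t0; apply/eqP; suff : t \in @zero_sub k {malg k[S]} by [].
by apply: malg_map_ker t0 => s s' /fi->; rewrite inE subrr.
Qed.

(** In the resolution of k[M], for M cyclic, by the bar complex, the term of
    index 0 is projective and the others are linearizations of additive functors
    to which the induction hypothesis applies, in a degree lower by one.  The
    induction needs all additive functors, as N need not be finitely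
    generated. *)
Lemma acyclic_kfree n M : acyclic p n (kfree k M).
Proof.
elim: n M => // n IHn M; apply: acyclic_local => l.
pose elt z (s : M z) : {classic {z : A & M z}} := existT (fun z => M z : Type) z s.
pose elts (g : {classic {z : A & kfree k M z}}) : seq {classic {z : A & M z}} :=
  [seq elt (projT1 g) s | s <- msupp (projT2 g : {malg k[M (projT1 g)]})].
have [x [m mP]] := generated_by_one (flatten [seq elts g | g <- l]).
have nu y z (f : hom y z) (s : cyclic_sub m y) :
  val (amap (cyclic_sub m) f s) = amap M f (val s) by [].
exists (kfree k (cyclic_sub m)), (kfree_nat k nu); split.
- by move=> z t; apply: malg_map_inj; exact: val_inj.
- apply: (acyclic_resolution (bar_aug_surj (m := m)) (bar_exact0 (m := m))
    (bar_exactS (m := m)) (bar_exactJ (m := m))) => -[|j] jn.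
    exact/acyclic_proj/bar_cplx0_projective.
  by rewrite subSS; apply: (acyclic_le (leq_subr j n)); exact: IHn.
- move=> [z t] gl /=.
  suff : t \in im_sub (kfree_nat k nu z) by move=> /asboolP.
  apply: malg_ind => s st.
  have [f fE] : exists f : hom x z, amap M f m = s.
    apply: (mP (elt z s)); apply/flattenP; exists (elts (existT _ z t)).
      exact: (map_f elts gl).
    exact: (map_f (elt z) st).
  have sI : s \in im_sub (evl m z) by apply/asboolP; exists f.
  by apply/asboolP; exists << (SubOf sI : cyclic_sub m z) >>; rewrite /= malg_mapE.
Qed.

End Linearizations.

(** * Pulled back functors are acyclic *)

Section Image.
Variables (k : fieldType) (C : cat) (F G : kfunctor k C) (u : nattrans F G).

Fact nat_im_subproof x y (f : hom x y) (s : G x) :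
  s \in im_sub (u x) -> kmap G f s \in im_sub (u y).
Proof.
by move=> /asboolP[r <-]; apply/asboolP; exists (kmap F f r); rewrite app_nat.
Qed.

Definition nat_im : kfunctor k C.
Proof.
refine (@KFunctor k C (fun x => sub_of (im_sub (u x)))
  (fun x y f => sub_map (@nat_im_subproof x y f)) _ _).
- by move=> x v; apply: val_inj; rewrite /= kmap1.
- by move=> x y z g f v; apply: val_inj; rewrite /= kmapM.
Defined.

Definition nat_im_incl : nattrans nat_im G.
Proof.
by refine (@Nattrans k C nat_im G
  (fun x => (val : {linear sub_of (im_sub (u x)) -> G x})) _).
Defined.

Fact im_in x (s : F x) : u x s \in im_sub (u x).
Proof. by apply/asboolP; exists s. Qed.

Fact nat_im_pi_linear x : linear (fun s : F x => SubOf (im_in s)).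
Proof. by move=> a s t; apply: val_inj; rewrite /= linearP. Qed.

Definition nat_im_pi : nattrans F nat_im.
Proof.
refine (@Nattrans k C F nat_im (fun x => lin_of (@nat_im_pi_linear x)) _).
by move=> x y f s; apply: val_inj; rewrite /= app_nat.
Defined.

Lemma ses_im_ker : ses (nat_ker_incl u) nat_im_pi.
Proof.
split.
- by move=> x s s0; apply: val_inj.
- by move=> x [t tI]; have [s sE] := asboolP _ tI; exists s; apply: val_inj.
- move=> x t /(congr1 val) /= t0.
  have tk : t \in ker_sub (u x) by rewrite inE t0.
  by exists (SubOf tk).
- by move=> x s; apply: val_inj; apply/eqP; exact: (sub_valP s).
Qed.

End Image.

Section Pulled.
Variables (k : fieldType).

Lemma acyclic_iso (C D : cat) (p : functor C D) n (G G' : kfunctor k C)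
    (u : nattrans G G') (v : nattrans G' G) :
  (forall x s, v x (u x s) = s) -> (forall x s, u x (v x s) = s) ->
  acyclic p n G -> acyclic p n G'.
Proof.
move=> vu uv; case: n => // n [K [P [i [e [[S1 S2 S3 S4] pP pi aK]]]]].
exists K, P, i, (nat_comp u e); split=> //; split=> //.
- move=> x t; have [s sE] := S2 x (v x t).
  by exists s; rewrite /= sE uv.
- move=> x t /= t0; apply: S3.
  by rewrite -(vu x (e x t)) t0 linear0.
- by move=> x s; rewrite /= S4 linear0.
Qed.

Lemma ses_pull (C D : cat) (p : functor C D) (K E G : kfunctor k D)
    (i : nattrans K E) (e : nattrans E G) :
  ses i e -> ses (pull_nat p i) (pull_nat p e).
Proof.
move=> [S1 S2 S3 S4]; split.
- by move=> x; apply: S1.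
- by move=> x t; exact: (S2 (p x) t).
- by move=> x t; apply: S3.
- by move=> x s; apply: S4.
Qed.

Variables (A B : addcat) (p : functor A B).
Hypothesis p_additive : additive_functor p.
Hypothesis B_tors : forall x : B, exists2 n : nat, n%:R != 0 :> k &
  (aid x *+ n : ahom x x) = 0.

Lemma fmorD_eq (x y : A) (f f' g : ahom x y) :
  fmor p f = fmor p f' -> fmor p (f + g : ahom x y) = fmor p (f' + g : ahom x y).
Proof. by move=> e; rewrite !p_additive e. Qed.

Lemma fmor_tors (x : A) : exists2 n : nat, n%:R != 0 :> k &
  fmor p (aid x *+ n : ahom x x) = fmor p (0 : ahom x x).
Proof.
have [n n0 tn] := B_tors (p x); exists n => //.
have p0 (y z : A) : fmor p (0 : ahom y z) = 0 :> ahom (p y) (p z).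
  by apply: (@addrI _ (fmor p (0 : ahom y z))); rewrite -p_additive !addr0.
have pn m : fmor p (aid x *+ m : ahom x x) = aid (p x) *+ m :> ahom (p x) (p x).
  elim: m => [|m IH]; first exact: p0.
  by rewrite !mulrS p_additive IH; congr (_ + _); exact: (fmor1 p x).
by rewrite pn tn p0.
Qed.

Lemma acyclic_pull_rep n (b : B) : acyclic p n (pull p (kfree k (rep b))).
Proof.
pose M := rep_pull p_additive b.
pose u : nattrans (kfree k M) (pull p (kfree k (rep b))) :=
  @Nattrans k A (kfree k M) (pull p (kfree k (rep b))) (fun z => idfun) (fun _ _ _ _ => erefl).
pose v : nattrans (pull p (kfree k (rep b))) (kfree k M) :=
  @Nattrans k A (pull p (kfree k (rep b))) (kfree k M) (fun z => idfun) (fun _ _ _ _ => erefl).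
apply: (acyclic_iso (u := u) (v := v)) => //.
exact: (acyclic_kfree fmorD_eq fmor_tors).
Qed.

Lemma acyclic_generators n (F : kfunctor k B) (l : seq {classic {b : B & F b}}) :
  exists (S : kfunctor k B) (u : nattrans S F),
    acyclic p n (pull p S) /\ forall g, g \in l -> exists s, u _ s = projT2 g.
Proof.
elim: l => [|[b s] l [S [u [aS uP]]]].
  have [z _] := azero B.
  by exists (kfree k (rep z)), (nat_zero _ _); split=> //; exact: acyclic_pull_rep.
have [v vE] := rep_yoneda s.
exists (nat_sum (kfree k (rep b)) S), (nat_copair v u); split.
  apply: (acyclic_ext (ses_pull p (ses_sum (kfree k (rep b)) S))) => //.
  exact: acyclic_pull_rep.
move=> g; rewrite inE => /orP[/eqP->|/uP[r rE]].
  by exists (<< idc b : rep b b >>, 0); rewrite /= linear0 addr0 vE kmap1.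
by exists (0, r); rewrite /= linear0 add0r.
Qed.

(** F may be taken finitely generated, so that it is a quotient of a finite sum S
    of standard projectives of k[B]-Mod, with kernel K.  As J vanishes on the
    pulled back functors, purity of K in S is automatic, and K is acyclic up to
    degree n by induction. *)
Lemma acyclic_pull n (F : kfunctor k B) : acyclic p n (pull p F).
Proof.
elim: n F => // n IHn F; apply: acyclic_local => l.
pose elt (g : {classic {x : A & pull p F x}}) : {classic {b : B & F b}} :=
  existT (fun b => F b : Type) (p (projT1 g)) (projT2 g).
have [S [u [aS uP]]] := acyclic_generators n.+1 (map elt l).
exists (pull p (nat_im u)), (pull_nat p (nat_im_incl u)); split.
- by move=> x s s0; apply: val_inj.
- have T := ses_pull p (ses_im_ker u).
  apply: (acyclic_quot T) aS => // x s /J_pull s0.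
  by rewrite (ses_inj T s0) rpred0.
- move=> g gl; have [s sE] := uP _ (map_f elt gl).
  by exists (SubOf (im_in u s)); exact: sE.
Qed.

End Pulled.

(** * Comparison of projective resolutions *)

Section Comparison.
Variables (k : fieldType) (C : cat).

Lemma lift_exact (P X Y Z : kfunctor k C) (d : nattrans X Y) (e : nattrans Y Z)
    (u : nattrans P Y) :
  projective P -> (forall x t, e x t = 0 -> exists r, d x r = t) ->
  (forall x t, e x (u x t) = 0) ->
  exists v : nattrans P X, forall x t, d x (v x t) = u x t.
Proof.
move=> pP ex eu.
have uI x t : u x t \in im_sub (d x) by apply/asboolP/ex.
have lu x : linear (fun t => SubOf (uI x t)).
  by move=> a s t; apply: val_inj; rewrite /= linearP.
have nu x y (f : hom x y) t :
    lin_of (lu y) (kmap P f t) = kmap (nat_im d) f (lin_of (lu x) t).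
  by apply: val_inj; rewrite /= app_nat.
have sd := ses_surj (ses_im_ker d).
have [v vE] := proj_lift (@Nattrans k C P (nat_im d) _ nu) pP sd.
by exists v => x t; have /(congr1 val) := vE x t.
Qed.

Variable F : kfunctor k C.
Implicit Types P X : proj_res F.

(** With [res_bd], the resolution augmented by F, the augmentation being the
    boundary in degree 0; this lets the inductions below start uniformly. *)
Definition res_tgt X (n : nat) : kfunctor k C := if n is m.+1 then X m else F.
Definition res_bd X (n : nat) : nattrans (X n) (res_tgt X n) :=
  match n with 0 => res_aug X | m.+1 => res_d X m end.

Lemma res_exact X n x (t : X n x) :
  res_bd X n x t = 0 <-> exists r, res_d X n x r = t.
Proof. by case: n t => [|n] t; [exact: res_exact0|exact: res_exactS]. Qed.

Lemma res_dd X n x (t : X n.+1 x) : res_bd X n x (res_d X n x t) = 0.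
Proof. by apply/res_exact; exists t. Qed.

Definition chain_map P X (s : forall n, nattrans (P n) (X n)) : Prop :=
  forall n x t, res_d X n x (s n.+1 x t) = s n x (res_d P n x t).

Lemma comparison P X : exists s : forall n, nattrans (P n) (X n),
  chain_map s /\ forall x t, res_aug X x (s 0%N x t) = res_aug P x t.
Proof.
pose good n (s : nattrans (P n) (X n)) :=
  forall x t, res_bd X n x (s x (res_d P n x t)) = 0.
have step n (s : nattrans (P n) (X n)) : good n s ->
    exists s' : nattrans (P n.+1) (X n.+1),
      (forall x t, res_d X n x (s' x t) = s x (res_d P n x t)) /\ good n.+1 s'.
  move=> gs.
  have [s' s'E] := @lift_exact (P n.+1) _ _ _ (res_d X n) (res_bd X n)
    (nat_comp s (res_d P n)) (@res_proj k C F P n.+1)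
    (fun x t => (res_exact t).1) gs.
  exists s'; split=> // x t; rewrite /= s'E /=.
  by have /= -> := @res_dd P n.+1 x t; rewrite linear0.
have [s0 s0E] := proj_lift (res_aug P) (@res_proj k C F P 0) (@res_aug_surj k C F X).
have g0 : good 0%N s0 by move=> x t; rewrite /= s0E; exact: (@res_dd P 0).
pose B := fix B n : {s | good n s} := match n with
  | 0 => exist (good 0%N) s0 g0
  | m.+1 => let s := B m in
     exist (good m.+1) (projT1 (cid (step m (sval s) (svalP s))))
       (projT2 (cid (step m (sval s) (svalP s)))).2
  end.
exists (fun n => sval (B n)); split=> // n x t /=.
by case: cid => s' [].
Qed.

(** The homotopy in degree n + 1 lifts e - h d, a cycle because h already satisfies
    the homotopy relation on boundaries; this is the invariant of the
    induction. *)
Lemma null_homotopy P X (e : forall n, nattrans (P n) (X n)) :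
  chain_map e -> (forall x t, res_aug X x (e 0%N x t) = 0) ->
  exists h : forall n, nattrans (P n) (X n.+1),
    (forall x t, e 0%N x t = res_d X 0 x (h 0%N x t)) /\
    (forall n x t, e n.+1 x t = res_d X n.+1 x (h n.+1 x t) + h n x (res_d P n x t)).
Proof.
move=> ce e0.
pose good n (h : nattrans (P n) (X n.+1)) :=
  forall x t, res_d X n x (h x (res_d P n x t)) = e n x (res_d P n x t).
have step n (h : nattrans (P n) (X n.+1)) : good n h ->
    exists h' : nattrans (P n.+1) (X n.+2),
      (forall x t, e n.+1 x t = res_d X n.+1 x (h' x t) + h x (res_d P n x t))
      /\ good n.+1 h'.
  move=> gh.
  pose u := nat_add (e n.+1) (nat_opp (nat_comp h (res_d P n))).
  have u0 x t : res_d X n x (u x t) = 0 by rewrite /= linearB ce gh subrr.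
  have [h' h'E] := @lift_exact (P n.+1) _ _ _ (res_d X n.+1) (res_d X n)
    u (@res_proj k C F P n.+1) (fun x t => (@res_exactS k C F X n x t).1) u0.
  exists h'; split=> [x t|x t]; first by rewrite h'E /= subrK.
  rewrite h'E /=.
  by have /= -> := @res_dd P n.+1 x t; rewrite linear0 subr0.
have [h0 h0E] := @lift_exact (P 0%N) _ _ _ (res_d X 0) (res_aug X)
    (e 0%N) (@res_proj k C F P 0) (fun x t => (@res_exact0 k C F X x t).1) e0.
have g0 : good 0%N h0 by move=> x t; rewrite h0E.
pose B := fix B n : {h | good n h} := match n with
  | 0 => exist (good 0%N) h0 g0
  | m.+1 => let s := B m in
     exist (good m.+1) (projT1 (cid (step m (sval s) (svalP s))))
       (projT2 (cid (step m (sval s) (svalP s)))).2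
  end.
exists (fun n => sval (B n)); split=> // n x t /=.
by case: cid => s' [].
Qed.

Lemma comparison_inverse P X (f : forall n, nattrans (P n) (X n)) :
  chain_map f -> (forall x t, res_aug X x (f 0%N x t) = res_aug P x t) ->
  exists s : forall n, nattrans (X n) (P n), chain_map s /\
    (exists h : forall n, nattrans (P n) (P n.+1),
      (forall x t, t - s 0%N x (f 0%N x t) = res_d P 0 x (h 0%N x t)) /\
      (forall n x t, t - s n.+1 x (f n.+1 x t) =
         res_d P n.+1 x (h n.+1 x t) + h n x (res_d P n x t))) /\
    (exists h : forall n, nattrans (X n) (X n.+1),
      (forall x t, t - f 0%N x (s 0%N x t) = res_d X 0 x (h 0%N x t)) /\
      (forall n x t, t - f n.+1 x (s n.+1 x t) =
         res_d X n.+1 x (h n.+1 x t) + h n x (res_d X n x t))).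
Proof.
move=> cf af; have [s [cs as0]] := comparison X P.
exists s; split=> //; split.
- pose e n := nat_add (nat_id (P n)) (nat_opp (nat_comp (s n) (f n))).
  have ce : chain_map e by move=> n x t; rewrite /= linearB cs cf.
  have [|h hE] := null_homotopy ce; last by exists h.
  by move=> x t; rewrite /= linearB as0 af subrr.
- pose e n := nat_add (nat_id (X n)) (nat_opp (nat_comp (f n) (s n))).
  have ce : chain_map e by move=> n x t; rewrite /= linearB cf cs.
  have [|h hE] := null_homotopy ce; last by exists h.
  by move=> x t; rewrite /= linearB af as0 subrr.
Qed.

End Comparison.

Lemma subquo_map_bij (R : nzRingType) (V V' : lmodType R) (Z B : submodClosed V)
    (Z' B' : submodClosed V') (f : {linear V -> V'})
    (fZ : forall v, v \in Z -> f v \in Z') (fB : forall v, v \in B -> f v \in B') :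
  (forall v, v \in Z -> f v \in B' -> v \in B) ->
  (forall w, w \in Z' -> exists2 v, v \in Z & w - f v \in B') ->
  bijective (subquo_map fZ fB).
Proof.
move=> fi fs; set g := subquo_map fZ fB.
have gE z : g (subquo_pi B z) = subquo_pi B' (sub_map fZ z) by exact: quot_liftE.
have gi : injective g.
  move=> q r; rewrite -(quot_piP q) -(quot_piP r).
  move: (repr _) (repr _) => w z e; apply/quot_eqP.
  apply: fi; first exact: sub_valP.
  have /quot_eqP := etrans (etrans (esym (gE z)) e) (gE w).
  by rewrite inE /= -linearB.
have gs r : exists q, g q = r.
  rewrite -(quot_piP r); move: (repr _) => w.
  have [v vZ vE] := fs _ (sub_valP w); exists (subquo_pi B (SubOf vZ)).
  rewrite gE; apply/quot_eqP; rewrite inE /=.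
  by rewrite -opprB -scaleN1r rpredZ.
exists (fun r => projT1 (cid (gs r))) => [q|r]; last by case: cid.
by apply: gi; case: cid.
Qed.

(** * Left Kan extension along a full and essentially surjective functor *)

Section Descent.
Variables (k : fieldType) (C D : cat) (p : functor C D).
Hypothesis p_full : full p.
Hypothesis p_esurj : essentially_surjective p.

Notation J G x := (J_sub p G x).

Fact section_exists (y : D) :
  exists d : {x : C & (hom (p x) y * hom y (p x))%type},
    compc (projT2 d).2 (projT2 d).1 = idc (p (projT1 d)) /\
    compc (projT2 d).1 (projT2 d).2 = idc y.
Proof. by have [x [f [g fg]]] := p_esurj y; exists (existT _ x (f, g)). Qed.

Definition preobj (y : D) : C := projT1 (projT1 (cid (section_exists y))).
Definition preobj_out (y : D) : hom (p (preobj y)) y := (projT2 (projT1 (cid (section_exists y)))).1.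
Definition preobj_in (y : D) : hom y (p (preobj y)) := (projT2 (projT1 (cid (section_exists y)))).2.
Lemma preobj_inK y : compc (preobj_in y) (preobj_out y) = idc (p (preobj y)).
Proof. exact: (projT2 (cid (section_exists y))).1. Qed.
Lemma preobj_outK y : compc (preobj_out y) (preobj_in y) = idc y.
Proof. exact: (projT2 (cid (section_exists y))).2. Qed.

Definition prehom (x y : C) (g : hom (p x) (p y)) : hom x y := projT1 (cid (p_full g)).
Lemma prehomE x y g : fmor p (@prehom x y g) = g.
Proof. by rewrite /prehom; case: cid. Qed.

Lemma J_kmap (G : kfunctor k C) x y (f : hom x y) t :
  t \in J G x -> kmap G f t \in J G y.
Proof.
pose S := preim_sub (kmap G f) (J G y).
move: t; apply: (@J_min k C D p G x S) => _ [z [g [h [s [gh ->]]]]].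
change (kmap G f (kmap G g s - kmap G h s) \in J G y).
by rewrite linearB -!kmapM J_in // !fmorM gh.
Qed.

Section Lan.
Variable G : kfunctor k C.

Definition lan_pi x : {linear G x -> quot_of (J G x)} := quot_pi (J G x).

Lemma lan_pi_eq x y (f g : hom x y) t : fmor p f = fmor p g ->
  lan_pi y (kmap G f t) = lan_pi y (kmap G g t).
Proof. by move=> fg; apply/quot_eqP; apply: J_in. Qed.

Lemma lan_pi0 x t : lan_pi x t = 0 <-> t \in J G x.
Proof.
rewrite -(linear0 (lan_pi x)); split=> [/quot_eqP|tJ]; first by rewrite subr0.
by apply/quot_eqP; rewrite subr0.
Qed.

Fact lan_map_subproof x y (f : hom x y) t :
  t \in J G x -> (lan_pi y \o kmap G f) t = 0.
Proof. by move=> tJ; apply/lan_pi0/J_kmap. Qed.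

Definition lan_mor y z (g : hom y z) : hom (preobj y) (preobj z) :=
  prehom (compc (preobj_in z) (compc g (preobj_out y))).

Definition lan_map y z (g : hom y z) :
  {linear quot_of (J G (preobj y)) -> quot_of (J G (preobj z))} :=
  quot_lift (lan_map_subproof (lan_mor g)).

Lemma lan_mapE y z (g : hom y z) t :
  lan_map g (lan_pi (preobj y) t) = lan_pi (preobj z) (kmap G (lan_mor g) t).
Proof. exact: quot_liftE. Qed.

Lemma lan_ind x (P : quot_of (J G x) -> Prop) : (forall t, P (lan_pi x t)) -> forall q, P q.
Proof. by move=> h q; rewrite -(quot_piP q); apply: h. Qed.

(** Functorial in y, even though lifts of morphisms along p are chosen: two lifts
    act in the same way modulo J. *)
Definition lan : kfunctor k D.
Proof.
refine (@KFunctor k D (fun y => quot_of (J G (preobj y))) lan_map _ _).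
- move=> y; apply: lan_ind => t; rewrite lan_mapE -[in RHS](kmap1 t).
  by apply: lan_pi_eq; rewrite prehomE fmor1 comp1c preobj_inK.
- move=> x y z g f; apply: lan_ind => t; rewrite (lan_mapE _ t) (lan_mapE f t) (lan_mapE g) -kmapM.
  apply: lan_pi_eq; rewrite fmorM !prehomE.
  by rewrite -!compcA (compcA (preobj_out y)) preobj_outK comp1c.
Defined.

Fact lan_unit_linear x :
  linear (fun t : G x => lan_pi (preobj (p x)) (kmap G (prehom (preobj_in (p x))) t)).
Proof. by move=> a u v; rewrite !linearP. Qed.

Definition lan_unit : nattrans G (pull p lan).
Proof.
refine (@Nattrans k C G (pull p lan) (fun x => lin_of (@lan_unit_linear x)) _).
move=> x y f t; apply: etrans (esym (lan_mapE (fmor p f) _)).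
change (lan_pi (preobj (p y)) (kmap G (prehom (preobj_in (p y))) (kmap G f t)) =
  lan_pi (preobj (p y)) (kmap G (lan_mor (fmor p f)) (kmap G (prehom (preobj_in (p x))) t))).
rewrite -!kmapM; apply: lan_pi_eq.
by rewrite !fmorM !prehomE -!compcA preobj_outK compc1.
Defined.

(** Lifts along p of an isomorphism and of its inverse compose to a morphism
    that p identifies with the identity, hence acts as the identity modulo J. *)
Lemma lan_unit0 x t : lan_unit x t = 0 <-> t \in J G x.
Proof.
split=> [/lan_pi0 h|tJ]; last by apply/lan_pi0/J_kmap.
have h' := J_kmap (prehom (preobj_out (p x))) h.
rewrite -(subrK (kmap G (prehom (preobj_out (p x))) (kmap G (prehom (preobj_in (p x))) t)) t).
rewrite rpredD // -kmapM -[X in X - _](kmap1 t).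
by apply: J_in; rewrite fmorM !prehomE fmor1 preobj_outK.
Qed.

Lemma lan_gen y (q : lan y) : exists t : G (preobj y),
  q = kmap lan (preobj_out y) (lan_unit (preobj y) t).
Proof.
move: q; apply: lan_ind => t; exists t; apply: etrans (esym (lan_mapE (preobj_out y) _)).
rewrite -kmapM -[in LHS](kmap1 t); apply: lan_pi_eq.
by rewrite fmorM !prehomE fmor1 -!compcA preobj_outK compc1 preobj_inK.
Qed.

Lemma lan_ext (H : kfunctor k D) (u v : nattrans lan H) :
  (forall x t, u (p x) (lan_unit x t) = v (p x) (lan_unit x t)) ->
  forall y q, u y q = v y q.
Proof. by move=> h y q; have [t ->] := lan_gen q; rewrite !app_nat h. Qed.

Section Desc.
Variables (H : kfunctor k D) (u : nattrans G (pull p H)).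

Fact lan_desc_subproof y t : t \in J G (preobj y) ->
  (kmap H (preobj_out y) \o u (preobj y)) t = 0.
Proof. by move=> /(J_nat u) /J_pull /= ->; rewrite linear0. Qed.

Definition lan_desc : nattrans lan H.
Proof.
refine (@Nattrans k D lan H (fun y => quot_lift (@lan_desc_subproof y)) _).
move=> y z g; apply: lan_ind => t.
rewrite [kmap lan g _]lan_mapE !quot_liftE /= app_nat /= prehomE -!kmapM.
by rewrite compcA preobj_outK comp1c.
Defined.

Lemma lan_descE x t : lan_desc (p x) (lan_unit x t) = u x t.
Proof.
apply: etrans (quot_liftE _ _) _.
by rewrite /= app_nat /= prehomE -kmapM preobj_outK [LHS]kmap1.
Qed.

End Desc.
End Lan.

(** p_! is left adjoint to the pullback, which preserves surjections. *)
Lemma lan_projective (P : kfunctor k C) : projective P -> projective (lan P).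
Proof.
move=> pP M N e u se.
have se' : nat_surj (pull_nat p e) by move=> x t; exact: (se (p x) t).
have [v vE] := proj_lift (nat_comp (pull_nat p u) (lan_unit P)) pP se'.
exists (lan_desc v); apply: nattrans_ext; apply: lan_ext => x t.
apply: etrans (congr1 (e (p x)) (lan_descE v t)) _; exact: vE.
Qed.

Definition lan_nat (G G' : kfunctor k C) (u : nattrans G G') : nattrans (lan G) (lan G') :=
  lan_desc (nat_comp (lan_unit G') u).

Lemma lan_natE (G G' : kfunctor k C) (u : nattrans G G') x t :
  lan_nat u (p x) (lan_unit G x t) = lan_unit G' x (u x t).
Proof. exact: lan_descE. Qed.

Lemma kmap_out_inj (H : kfunctor k D) y (s : H (p (preobj y))) :
  kmap H (preobj_out y) s = 0 -> s = 0.
Proof. by move=> h; rewrite -(kmap1 s) -preobj_inK kmapM h linear0. Qed.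

Section LanRes.
Variables (F : kfunctor k D) (Q : proj_res (pull p F)).
Hypothesis QJ : forall n x (t : Q n.+1 x), res_d Q n x t \in J (Q n) x ->
  exists r, t - res_d Q n.+1 x r \in J (Q n.+1) x.

(** Exactness is checked on values of the unit, where it becomes exactness of Q
    modulo J: in degree 0 it follows from that of Q and the vanishing of J on the
    pullback of F, in higher degrees it is the hypothesis QJ. *)
Definition lan_res : proj_res F.
Proof.
refine (@ProjRes k D F (fun n => lan (Q n)) (fun n => lan_nat (res_d Q n))
  (lan_desc (res_aug Q)) _ _ _ _).
- by move=> n; apply/lan_projective/res_proj.
- move=> y t; have [r rE] := res_aug_surj Q (kmap F (preobj_in y) t : pull p F (preobj y)).
  exists (kmap (lan (Q 0)) (preobj_out y) (lan_unit (Q 0) (preobj y) r)).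
  by rewrite app_nat lan_descE rE -kmapM preobj_outK kmap1.
- move=> y q; split=> [|[r <-]]; last first.
    pose z : nattrans (lan (Q 1)) F := nat_zero _ _.
    pose w := nat_comp (lan_desc (res_aug Q)) (lan_nat (res_d Q 0)).
    apply: (@lan_ext (Q 1) F w z) => x t; rewrite /w [LHS]/=.
    apply: etrans (congr1 (lan_desc (res_aug Q) (p x)) (lan_natE _ _)) _.
    by rewrite lan_descE; apply: (@res_exact0 k C (pull p F) Q x (res_d Q 0 x t)).2; exists t.
  have [t ->] := lan_gen q; rewrite app_nat lan_descE => /kmap_out_inj t0.
  have [r <-] := (@res_exact0 k C (pull p F) Q (preobj y) t).1 t0.
  exists (kmap (lan (Q 1)) (preobj_out y) (lan_unit (Q 1) (preobj y) r)).
  by rewrite app_nat lan_natE.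
- move=> n y q; split=> [|[r <-]]; last first.
    pose z : nattrans (lan (Q n.+2)) (lan (Q n)) := nat_zero _ _.
    pose w := nat_comp (lan_nat (res_d Q n)) (lan_nat (res_d Q n.+1)).
    apply: (@lan_ext (Q n.+2) _ w z) => x t; rewrite /w [LHS]/=.
    apply: etrans (congr1 (lan_nat (res_d Q n) (p x)) (lan_natE _ _)) _.
    rewrite lan_natE (_ : res_d Q n x _ = 0) ?linear0 //.
    by apply/res_exactS; exists t.
  have [t ->] := lan_gen q; rewrite app_nat lan_natE => /kmap_out_inj.
  move=> /lan_unit0 /QJ[r rJ].
  exists (kmap (lan (Q n.+2)) (preobj_out y) (lan_unit (Q n.+2) (preobj y) r)).
  rewrite app_nat lan_natE; congr (kmap _ _ _); apply/eqP.
  by rewrite eq_sym -subr_eq0 -linearB; apply/eqP/lan_unit0.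
Defined.

End LanRes.
End Descent.

(** * Ext and Tor through the Kan extension *)

Section TensorFunctoriality.
Variables (k : fieldType) (C : cat) (F : kfunctor k (opcat C)).

Lemma tens_eq (G : kfunctor k C) (V : lmodType k) (f g : {linear tens F G -> V}) :
  (forall (x : C) (s : F x) (t : G x), f (tens_el s t) = g (tens_el s t)) ->
  forall t, f t = g t.
Proof. by move=> /tens_ext ->. Qed.

Lemma tens_mapr_id (G : kfunctor k C) t : tens_mapr F (nat_id G) t = t.
Proof. by apply: (@tens_eq _ _ (tens_mapr F (nat_id G)) idfun) => x s r; exact: tens_maprE. Qed.

Lemma tens_mapr_comp (G H K : kfunctor k C) (v : nattrans H K) (u : nattrans G H)
    (w : nattrans G K) t : (forall x s, w x s = v x (u x s)) ->
  tens_mapr F w t = tens_mapr F v (tens_mapr F u t).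
Proof.
move=> wE; apply: (@tens_eq _ _ _ (tens_mapr F v \o tens_mapr F u)) => x s r.
apply: etrans (tens_maprE _ _ _) _; rewrite wE; apply/esym.
by apply: etrans (congr1 (tens_mapr F v) (tens_maprE u s r)) _; exact: tens_maprE.
Qed.

Lemma tens_maprD (G H : kfunctor k C) (u v w : nattrans G H) t :
  (forall x s, w x s = u x s + v x s) ->
  tens_mapr F w t = tens_mapr F u t + tens_mapr F v t.
Proof.
move=> wE; apply: (@tens_eq _ _ _ (tens_mapr F u \+ tens_mapr F v)) => x s r.
apply: etrans (tens_maprE _ _ _) _; rewrite wE.
apply: etrans (linearD (lin_of (tens_el_linearr s)) _ _) _.
by congr (_ + _); exact/esym/tens_maprE.
Qed.

Lemma tens_homotopy0 (M N K : kfunctor k C) (a : nattrans M N) (b : nattrans N M)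
    (h : nattrans M K) (d : nattrans K M) t :
  (forall x s, s - b x (a x s) = d x (h x s)) ->
  t - tens_mapr F b (tens_mapr F a t) = tens_mapr F d (tens_mapr F h t).
Proof.
move=> e; rewrite -(@tens_mapr_comp _ _ _ d h (nat_comp d h)) //.
rewrite -(@tens_mapr_comp _ _ _ b a (nat_comp b a)) //.
apply/eqP; rewrite subr_eq -{1}(tens_mapr_id t); apply/eqP.
by apply: tens_maprD => x s /=; rewrite -e subrK.
Qed.

Lemma tens_homotopyS (M N K K' : kfunctor k C) (a : nattrans M N) (b : nattrans N M)
    (h : nattrans M K) (d : nattrans K M) (d' : nattrans M K') (h' : nattrans K' M) t :
  (forall x s, s - b x (a x s) = d x (h x s) + h' x (d' x s)) ->
  t - tens_mapr F b (tens_mapr F a t) =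
  tens_mapr F d (tens_mapr F h t) + tens_mapr F h' (tens_mapr F d' t).
Proof.
move=> e; rewrite -(@tens_mapr_comp _ _ _ d h (nat_comp d h)) //.
rewrite -(@tens_mapr_comp _ _ _ h' d' (nat_comp h' d')) //.
rewrite -(@tens_maprD _ _ _ _ (nat_add (nat_comp d h) (nat_comp h' d'))) //.
rewrite -(@tens_mapr_comp _ _ _ b a (nat_comp b a)) //.
apply/eqP; rewrite subr_eq -{1}(tens_mapr_id t); apply/eqP.
by apply: tens_maprD => x s /=; rewrite -e subrK.
Qed.

End TensorFunctoriality.

Section TensorLan.
Variables (k : fieldType) (C D : cat) (p : functor C D).
Hypothesis (p_full : full p) (p_esurj : essentially_surjective p).
Variables (F : kfunctor k (opcat D)).

Notation pF := (pull (opfunctor p) F).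
Notation lan := (lan p_full p_esurj).
Notation unit := (lan_unit p_full p_esurj).

Definition tens_lan (G : kfunctor k C) : {linear tens pF G -> tens F (lan G)} :=
  tens_res p F (lan G) \o tens_mapr pF (unit G).

Lemma tens_lanE (G : kfunctor k C) (x : C) (s : F (p x)) (t : G x) :
  tens_lan G (@tens_el k C pF G x s t) = @tens_el k D F (lan G) (p x) s (unit G x t).
Proof.
apply: etrans (congr1 (tens_res p F (lan G)) 
  (@tens_maprE k C pF G (pull p (lan G)) (unit G) x s t)) _.
exact: tens_resE.
Qed.

Notation Fop := (fun (y z : D) (g : @hom D y z) => @kmap k (opcat D) F z y g).

(** p^* F tensor G = F tensor p_! G.  The inverse moves s in F(y) to the chosen
    preimage of y along the chosen isomorphism; it is well defined on G / J G
    since a difference of morphisms identified by p can be moved onto F, where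
    it acts by 0. *)
Lemma tens_lan_inverse (G : kfunctor k C) : exists psi : tens F (lan G) -> tens pF G,
  cancel (tens_lan G) psi /\ cancel psi (tens_lan G).
Proof.
have FM (x y z : D) (g : hom y z) (f : hom x y) (v : F z) :
    Fop x z (compc g f) v = Fop x y f (Fop y z g v).
  exact: (@kmapM k (opcat D) F z y x f g v).
have F1 (y : D) (v : F y) : Fop y y (idc y) v = v by exact: (@kmap1 k (opcat D) F).
pose h0 (y : D) (s : F y) : {linear G (preobj p_esurj y) -> tens pF G} :=
  lin_of (@tens_el_linearr k C pF G (preobj p_esurj y) (Fop _ _ (preobj_out p_esurj y) s)).
have hJ (y : D) (s : F y) t : t \in J_sub p G (preobj p_esurj y) -> h0 y s t = 0.
  move=> tJ; apply/eqP; suff : t \in ker_sub (h0 y s) by [].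
  move: t tJ; apply: J_min => _ [z [f [g [r [fg ->]]]]].
  rewrite inE linearB subr_eq0; apply/eqP.
  pose s' := Fop _ _ (preobj_out p_esurj y) s.
  have e (u : hom z (preobj p_esurj y)) : h0 y s (kmap G u r) =
      @tens_el k C pF G z (Fop _ _ (fmor p u) s') r.
    exact/esym/(@tens_el_dinat k C pF G).
  by rewrite !e fg.
pose h (y : D) (s : F y) : {linear lan G y -> tens pF G} := quot_lift (hJ y s).
have hE (y : D) (s : F y) t : h y s (lan_pi p G _ t) = @tens_el k C pF G (preobj p_esurj y)
    (Fop _ _ (preobj_out p_esurj y) s) t by exact: quot_liftE.
have hl (y : D) (q : lan G y) : linear (fun s => h y s q).
  move=> a s s'; move: q; apply: lan_ind => t; rewrite !hE linearP.
  exact: (@tens_el_linearl k C pF G).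
have hr (y : D) (s : F y) : linear (h y s) by move=> a u v; rewrite linearP.
have hd (y z : D) (g : hom y z) (s : F z) (q : lan G y) :
    h y (Fop _ _ g s) q = h z s (kmap (lan G) g q).
  move: q; apply: lan_ind => t.
  rewrite [kmap (lan G) g _]lan_mapE !hE.
  apply: etrans; last exact: (@tens_el_dinat k C pF G).
  congr tens_el; set u := lan_mor _ _ g.
  change (Fop _ _ (preobj_out p_esurj y) (Fop _ _ g s) =
    Fop _ _ (fmor p u) (Fop _ _ (preobj_out p_esurj z) s)).
  by rewrite -!FM prehomE compcA preobj_outK comp1c.
exists (tens_lift hl hr hd); split.
- move=> t; apply: (@tens_eq _ _ _ _ _ (tens_lift hl hr hd \o tens_lan G) idfun) => x s r.
  apply: etrans (congr1 (tens_lift hl hr hd) (tens_lanE s r)) _.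
  rewrite tens_liftE.
  apply: etrans (hE _ _ _) _; rewrite -(@tens_el_dinat k C pF G).
  congr tens_el; set u := prehom _ _.
  change (Fop _ _ (fmor p u) (Fop _ _ (preobj_out p_esurj (p x)) s) = s).
  by rewrite -FM prehomE preobj_outK F1.
- move=> t; apply: (@tens_eq _ _ _ _ _ (tens_lan G \o tens_lift hl hr hd) idfun) => y s.
  apply: lan_ind => r.
  apply: etrans (congr1 (tens_lan G) (tens_liftE _ _ _ _ _)) _.
  apply: etrans (congr1 (tens_lan G) (hE _ _ _)) _.
  apply: etrans (tens_lanE _ _) _.
  rewrite (@tens_el_dinat k D F (lan G)).
  congr tens_el; rewrite [LHS]lan_mapE -kmapM -[in RHS](kmap1 r).
  apply: lan_pi_eq; rewrite fmorM !prehomE.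
  by rewrite fmor1 -!compcA preobj_outK compc1 preobj_inK.
Qed.

Lemma tens_lan_nat (G G' : kfunctor k C) (u : nattrans G G') t :
  tens_lan G' (tens_mapr pF u t) = tens_mapr F (lan_nat p_full p_esurj u) (tens_lan G t).
Proof.
apply: (@tens_eq _ _ _ _ _ (tens_lan G' \o tens_mapr pF u)
  (tens_mapr F (lan_nat p_full p_esurj u) \o tens_lan G)) => x s r.
apply: etrans (congr1 (tens_lan G') (tens_maprE u s r)) _.
apply: etrans (tens_lanE _ _) _; rewrite -(lan_natE p_full p_esurj).
apply: esym; apply: etrans (congr1 (tens_mapr F _) (tens_lanE _ _)) _.
exact: tens_maprE.
Qed.

End TensorLan.

Section RestrictionMaps.
Variables (k : fieldType) (C D : cat) (p : functor C D).
Hypothesis (p_full : full p) (p_esurj : essentially_surjective p).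
Variables (M : kfunctor k D) (Q : proj_res (pull p M)) (X : proj_res M) (L : res_lift Q X).
Hypothesis QJ : forall n x (t : Q n.+1 x),
  res_d Q n x t \in J_sub p (Q n) x ->
  exists r, t - res_d Q n.+1 x r \in J_sub p (Q n.+1) x.

(* P is the resolution p_! Q; f is the transpose of L under the adjunction, a map
   between projective resolutions of M. *)
Let P := lan_res p_full p_esurj QJ.
Let f n : nattrans (P n) (X n) := lan_desc p_full p_esurj (L n).
Let unit n := lan_unit p_full p_esurj (Q n).

Lemma cmpE n x t : f n (p x) (unit n x t) = L n x t.
Proof. exact: lan_descE. Qed.

Lemma lan_dE n x t : res_d P n (p x) (unit n.+1 x t) = unit n x (res_d Q n x t).
Proof. exact: lan_natE. Qed.

Lemma cmp_chain : chain_map f.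
Proof.
move=> n y q.
pose u := nat_comp (res_d X n) (f n.+1); pose v := nat_comp (f n) (res_d P n).
apply: (lan_ext (u := u) (v := v)) => x t.
apply: etrans (congr1 (res_d X n (p x)) (cmpE t)) _; apply/esym.
apply: etrans (congr1 (f n (p x)) (lan_dE t)) _; rewrite cmpE.
exact: (nat_eqE (esym (lift_d L n)) t).
Qed.

Lemma cmp_aug y q : res_aug X y (f 0%N y q) = res_aug P y q.
Proof.
pose u := nat_comp (res_aug X) (f 0%N).
apply: (lan_ext (u := u) (v := res_aug P)) => x t.
apply: etrans (congr1 (res_aug X (p x)) (cmpE t)) _.
apply: etrans (nat_eqE (lift_aug L) t) _.
exact/esym/lan_descE.
Qed.

Lemma Ext_cobP (E : cat) (N : kfunctor k E) (R : proj_res N) (G : kfunctor k E) n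
    (v : nattrans (R n) G) :
  v \in Ext_cob R G n <->
  match n return nattrans (R n) G -> Prop with
  | 0 => fun v => forall x t, v x t = 0
  | m.+1 => fun v => exists w : nattrans (R m) G, forall x t, v x t = w x (res_d R m x t)
  end v.
Proof.
case: n v => [|n] v; split.
- by move=> /eqP -> x t.
- by move=> h; apply/eqP/nattrans_ext => x t; exact: h.
- by move=> /asboolP[w <-]; exists w.
- by move=> [w wE]; apply/asboolP; exists w; apply: nattrans_ext => x t; rewrite wE.
Qed.

Lemma Ext_cocycleP (E : cat) (N : kfunctor k E) (R : proj_res N) (G : kfunctor k E) n
    (v : nattrans (R n) G) :
  v \in ker_sub (precomp G (res_d R n)) <-> forall x t, v x (res_d R n x t) = 0.
Proof.
split=> [/eqP h x t|h]; first exact: (nat_eqE h t).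
by apply/eqP/nattrans_ext => x t; exact: h.
Qed.

(** Hom(Q, p^* G) = Hom(P, G), so that the restriction map is the composition
    with f, a homotopy equivalence. *)
Lemma Ext_res_of_bij (G : kfunctor k D) n : bijective (Ext_res_of L G n).
Proof.
have [s [cs [[h [h0 hS]] [h' [h'0 h'S]]]]] := comparison_inverse cmp_chain cmp_aug.
apply: subquo_map_bij; case: n => [|n] v /Ext_cocycleP vd.
- move=> /Ext_cobP vf; apply/Ext_cobP => x t.
  have vf0 y q : v y (f 0 y q) = 0.
    apply: (lan_ext (u := nat_comp v (f 0)) (v := nat_zero _ _)) => z r.
    by apply: etrans (congr1 (v (p z)) (cmpE r)) _; exact: vf.
  by rewrite -(subrK (f 0 x (s 0%N x t)) t) linearD vf0 addr0 h'0 vd.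
- move=> /Ext_cobP[w wE]; apply/Ext_cobP.
  pose w' := lan_desc p_full p_esurj w.
  have vf0 y q : v y (f n.+1 y q) = w' y (res_d P n y q).
    apply: (lan_ext (u := nat_comp v (f n.+1)) (v := nat_comp w' (res_d P n))) => z r.
    apply: etrans (congr1 (v (p z)) (cmpE r)) _; apply: etrans (wE z r) _.
    by apply/esym; apply: etrans (congr1 (w' (p z)) (lan_dE r)) _; exact: lan_descE.
  exists (nat_add (nat_comp w' (s n)) (nat_comp v (h' n))) => x t /=.
  rewrite -{1}(subrK (f n.+1 x (s n.+1 x t)) t) linearD vf0 h'S linearD vd add0r.
  by rewrite cs addrC.
- pose c := lan_desc p_full p_esurj v.
  have cd y q : c y (res_d P 0 y q) = 0.
    apply: (lan_ext (u := nat_comp c (res_d P 0)) (v := nat_zero _ _)) => z r.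
    apply: etrans (congr1 (c (p z)) (lan_dE r)) _; rewrite [LHS]lan_descE.
    exact: vd.
  exists (nat_comp c (s 0%N)).
    apply/Ext_cocycleP => x t.
    apply: etrans (congr1 (c x) (esym (cs _ _ _))) _; exact: cd.
  apply/Ext_cobP => x t.
  change (v x t - c (p x) (s 0%N (p x) (L 0%N x t)) = 0).
  by rewrite -(lan_descE p_full p_esurj v) -/c -cmpE -linearB h0 cd.
- pose c := lan_desc p_full p_esurj v.
  have cd y q : c y (res_d P n.+1 y q) = 0.
    apply: (lan_ext (u := nat_comp c (res_d P n.+1)) (v := nat_zero _ _)) => z r.
    apply: etrans (congr1 (c (p z)) (lan_dE r)) _; rewrite [LHS]lan_descE.
    exact: vd.
  exists (nat_comp c (s n.+1)).
    apply/Ext_cocycleP => x t.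
    apply: etrans (congr1 (c x) (esym (cs _ _ _))) _; exact: cd.
  apply/Ext_cobP; exists (nat_comp (pull_nat p (nat_comp c (h n))) (unit n)) => x t.
  change (v x t - c (p x) (s n.+1 (p x) (L n.+1 x t)) =
    c (p x) (h n (p x) (unit n x (res_d Q n x t)))).
  rewrite -(lan_descE p_full p_esurj v) -/c -cmpE -linearB hS linearD cd add0r.
  by rewrite lan_dE.
Qed.

Variable F : kfunctor k (opcat D).
Notation pF := (pull (opfunctor p) F).
Notation theta n := (tens_lan p_full p_esurj F (Q n)).

Lemma Tor_cycleP (E : cat) (H : kfunctor k (opcat E)) (N : kfunctor k E)
    (R : proj_res N) m (t : tens H (R m.+1)) :
  t \in Tor_cycle H R m.+1 <-> tens_mapr H (res_d R m) t = 0.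
Proof. by split=> [/eqP|tc]; last exact/eqP. Qed.

Lemma Tor_chainE n t : Tor_chain F L n t = tens_mapr F (f n) (theta n t).
Proof.
apply: (@tens_eq _ _ _ _ _ (Tor_chain F L n) (tens_mapr F (f n) \o theta n)) => x s r.
apply: etrans (congr1 (tens_res p F (X n)) (tens_maprE (L n) s r)) _.
apply: etrans (tens_resE _ _) _; rewrite -cmpE; apply: esym.
apply: etrans (congr1 (tens_mapr F (f n)) (tens_lanE _ _ _ _)) _.
exact: tens_maprE.
Qed.

(** Through p^* F tensor Q = F tensor P ([tens_lan_inverse]), the restriction map
    becomes the one induced by the homotopy equivalence f ([Tor_chainE]). *)
Lemma Tor_res_of_bij n : bijective (Tor_res_of F L n).
Proof.
have [s [cs [[h [h0 hS]] [h' [h'0 h'S]]]]] := comparison_inverse cmp_chain cmp_aug.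
have [psi [psiK thetaK]] := tens_lan_inverse p_full p_esurj F (Q n).
have theta_d m t : theta m (tens_mapr pF (res_d Q m) t) =
    tens_mapr F (res_d P m) (theta m.+1 t) by exact: tens_lan_nat.
have theta_cycle m (t : tens pF (Q m)) :
    t \in Tor_cycle pF Q m -> theta m t \in Tor_cycle F P m.
  case: m t => [//|m] t /Tor_cycleP tc; apply/Tor_cycleP.
  by rewrite -theta_d tc linear0.
have square (M1 M2 M3 M4 : kfunctor k D) (a : nattrans M1 M2) (b : nattrans M2 M3)
    (c : nattrans M1 M4) (d : nattrans M4 M3) t :
    (forall x s, b x (a x s) = d x (c x s)) ->
    tens_mapr F b (tens_mapr F a t) = tens_mapr F d (tens_mapr F c t).
  move=> e; rewrite -(@tens_mapr_comp _ _ F _ _ _ b a (nat_comp b a)) //.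
  exact: tens_mapr_comp.
have cyc_P (T : tens F (P n)) :
    T \in Tor_cycle F P n ->
    exists Y, T - tens_mapr F (s n) (tens_mapr F (f n) T) = tens_mapr F (res_d P n) Y.
  case: n T {psi psiK thetaK} => [|m] T Tc.
    by exists (tens_mapr F (h 0%N) T); apply: tens_homotopy0.
  exists (tens_mapr F (h m.+1) T).
  by rewrite (tens_homotopyS T (hS m)) (eqP Tc) linear0 addr0.
have cyc_X (T : tens F (X n)) :
    T \in Tor_cycle F X n ->
    exists Y, T - tens_mapr F (f n) (tens_mapr F (s n) T) = tens_mapr F (res_d X n) Y.
  case: n T {psi psiK thetaK cyc_P} => [|m] T Tc.
    by exists (tens_mapr F (h' 0%N) T); apply: tens_homotopy0.
  exists (tens_mapr F (h' m.+1) T).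
  by rewrite (tens_homotopyS T (h'S m)) (eqP Tc) linear0 addr0.
apply: subquo_map_bij.
- move=> t tc /asboolP[y yE]; apply/asboolP.
  have [Y YE] := cyc_P _ (theta_cycle n t tc).
  have [psi' [_ thetaK']] := tens_lan_inverse p_full p_esurj F (Q n.+1).
  exists (psi' (Y + tens_mapr F (s n.+1) y)); apply: (can_inj psiK).
  rewrite theta_d thetaK' linearD -YE (square _ _ _ _ _ _ _ _ y (cs n)) yE.
  by rewrite Tor_chainE subrK.
- move=> w wc; exists (psi (tens_mapr F (s n) w)).
    case: n w wc psi psiK thetaK {cyc_P cyc_X} => [//|m] w /Tor_cycleP wc psi psiK thetaK.
    have [psi' [psiK' _]] := tens_lan_inverse p_full p_esurj F (Q m).
    apply/Tor_cycleP; apply: (can_inj psiK'); rewrite theta_d thetaK linear0.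
    by rewrite (square _ _ _ _ (s m.+1) (res_d P m) (res_d X m) (s m)) ?wc ?linear0.
  rewrite Tor_chainE thetaK; have [Y ->] := cyc_X _ wc.
  by apply/asboolP; exists Y.
Qed.

End RestrictionMaps.

(** * Torsion in a k-trivial category *)

Section Torsion.

Lemma finite_torsion (E : zmodType) (e : E) :
  finite_set [set: E] -> exists2 n, (0 < n)%N & e *+ n = 0.
Proof.
move=> fE; have [h|h] := pselect (exists2 n, (0 < n)%N & e *+ n = 0) => //.
case: infinite_nat; rewrite -(preimage_setT (fun n => e *+ n)).
apply: finite_preimage => // i j _ _ eij.
wlog ij : i j eij / (i <= j)%N => [w|].
  by have [/w->|/ltnW /w->] := leqP i j.
case: (ltngtP i j) ij => // ij _; case: h; exists (j - i)%N; first by rewrite subn_gt0.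
by rewrite mulrnBr ?(ltnW ij) // eij subrr.
Qed.

Section Functional.
Variables (k : fieldType) (q : nat) (qk : q \in [pchar k]) (E : zmodType) (e : E).
Hypothesis eNq : forall z, e <> z *+ q.

Lemma intr_pchar (c : int) : (c%:~R == 0 :> k) = (q%:Z %| c)%Z.
Proof.
rewrite dvdzE /=; case: c => m; first by rewrite (dvdn_pcharf qk).
by rewrite NegzE mulrNz oppr_eq0 abszN (dvdn_pcharf qk).
Qed.

Lemma pchar_Bezout (c : int) : ~~ (q%:Z %| c)%Z ->
  exists u v : int, u * q%:Z + v * c = 1.
Proof.
move=> qc; have cop : coprimez q c.
  rewrite /coprimez /gcdz /= -[_ == _]/(coprime q `|c|).
  by rewrite prime_coprime ?(pcharf_prime qk).
by have [[u v] uv] := coprimezP _ _ cop; exists u, v.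
Qed.

Inductive qspan (H : set E) : E -> Prop :=
| qspan_mul z : qspan H (z *+ q)
| qspan_in h : H h -> qspan H h
| qspan_sub a b : qspan H a -> qspan H b -> qspan H (a - b).

Lemma qspan0 H : qspan H 0.
Proof. by rewrite -(mul0rn E q); exact: qspan_mul. Qed.
Lemma qspanN H a : qspan H a -> qspan H (- a).
Proof. by move=> ga; rewrite -sub0r; apply: qspan_sub => //; exact: qspan0. Qed.
Lemma qspanD H a b : qspan H a -> qspan H b -> qspan H (a + b).
Proof. by move=> ga gb; rewrite -[b]opprK; apply: qspan_sub => //; exact: qspanN. Qed.
Lemma qspanMz H a c : qspan H a -> qspan H (a *~ c).
Proof.
move=> ga; have gn n : qspan H (a *+ n).
  by elim: n => [|n IH]; [exact: qspan0|rewrite mulrS; exact: qspanD].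
by case: c => n; [exact: gn|rewrite NegzE mulrNz; apply/qspanN/gn].
Qed.
Lemma qspanMq H a (c : int) : (q%:Z %| c)%Z -> qspan H (a *~ c).
Proof. by move=> /dvdzP[d ->]; rewrite mulrzA; exact: qspan_mul. Qed.

Lemma qspan_mono (H H' : set E) a : (H `<=` H')%classic -> qspan H a -> qspan H' a.
Proof.
move=> HH'; elim=> [z|h /HH'|b c _ gb _ gc].
- exact: qspan_mul.
- exact: qspan_in.
- exact: qspan_sub.
Qed.

Lemma qspan_add H b a : qspan (H `|` [set b])%classic a ->
  exists (c : int), qspan H (a - b *~ c).
Proof.
elim=> [z|h [Hh|->]|a1 a2 _ [c1 g1] _ [c2 g2]].
- by exists 0; rewrite subr0; exact: qspan_mul.
- by exists 0; rewrite subr0; exact: qspan_in.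
- by exists 1; rewrite subrr; exact: qspan0.
- exists (c1 - c2).
  have -> : a1 - a2 - b *~ (c1 - c2) = (a1 - b *~ c1) - (a2 - b *~ c2).
    by rewrite mulrzBr !opprD !opprK addrACA.
  exact: qspan_sub.
Qed.

(** Zorn's lemma gives a subgroup containing q E that is maximal among those
    avoiding e.  Maximality means that E is generated by it and e: if b is not
    in it, then e = h + b c; as e avoids the subgroup, c is prime to q, and Bezout
    solves for b. *)
Lemma maximal_qspan : exists H : set E,
  ~ qspan H e /\ forall b, exists c : int, qspan H (b - e *~ c).
Proof.
have [F FP tF|H [eH Hmax]] := @Zorn_bigcup E [set H | ~ qspan H e]%classic.
  move=> ge.
  suff [[z ez]|[X FX gX]] : (exists z, e = z *+ q) \/ exists2 X, F X & qspan X e.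
  - exact: eNq ez.
  - exact: FP FX gX.
  elim: ge => [z|h [X FX Xh]|a b _ ga _ gb].
  - by left; exists z.
  - by right; exists X => //; exact: qspan_in.
  - case: ga => [[z ->]|[X FX gX]]; case: gb => [[z' ->]|[Y FY gY]].
    + by left; exists (z - z'); rewrite mulrnBl.
    + by right; exists Y => //; apply: qspan_sub => //; exact: qspan_mul.
    + by right; exists X => //; apply: qspan_sub => //; exact: qspan_mul.
    + have [XY|YX] := tF X Y FX FY.
        by right; exists Y => //; apply: qspan_sub => //; exact: qspan_mono gX.
      by right; exists X => //; apply: qspan_sub => //; exact: qspan_mono gY.
exists H; split=> // b.
have [gb|gb] := pselect (qspan H b); first by exists 0; rewrite subr0.
have : qspan (H `|` [set b])%classic e.
  apply: contrapT; apply: Hmax; split; first exact: subsetUl.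
  by move=> /(_ b (or_intror erefl)) Hb; apply/gb/qspan_in.
move=> /qspan_add[c gc].
have [qc|qc] := boolP (q%:Z %| c)%Z.
  by case: eH; rewrite -(subrK (b *~ c) e); apply: qspanD => //; exact: qspanMq.
have [u [v uv]] := pchar_Bezout qc.
exists v; have -> : b - e *~ v = (b *~ u) *+ q - (e - b *~ c) *~ v.
  have e1 : b *~ u *+ q + b *~ c *~ v = b.
    by rewrite pmulrn -!mulrzA -mulrzDr (mulrC c) uv mulr1z.
  by rewrite mulrzBl opprB addrA e1.
by apply: qspan_sub; [exact: qspan_mul|exact: qspanMz].
Qed.

(** A linear functional on the F_q-vector space E / q E, with values in k, that
    does not vanish on e: the coefficient along e with respect to the subgroup
    of [maximal_qspan]. *)
Lemma exists_functional : exists phi : E -> k, {morph phi : a b / a + b} /\ phi e = 1.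
Proof.
have [H [eH Hc]] := maximal_qspan.
pose c b : int := projT1 (cid (Hc b)).
have cP b : qspan H (b - e *~ c b) by rewrite /c; case: cid.
have c0 (d : int) : qspan H (e *~ d) -> d%:~R = 0 :> k.
  move=> gd; apply/eqP; rewrite intr_pchar; apply: contrapT => /negP qd.
  have [u [v uv]] := pchar_Bezout qd.
  apply: eH; rewrite -[e]mulr1z -uv mulrzDr; apply: qspanD.
    by apply: qspanMq; rewrite dvdz_mull.
  by rewrite mulrC mulrzA; exact: qspanMz.
have c_eq b d : qspan H (b - e *~ d) -> (c b)%:~R = d%:~R :> k.
  move=> gd; apply/eqP; rewrite -subr_eq0 -mulrzBr; apply/eqP/c0.
  have -> : e *~ (c b - d) = (b - e *~ d) - (b - e *~ c b).
    by rewrite mulrzBr opprB [RHS]addrC addrA subrK.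
  exact: qspan_sub (cP b).
exists (fun b => (c b)%:~R); split=> [a b|].
  rewrite -mulrzDr; apply: c_eq; rewrite mulrzDr opprD addrACA.
  by apply: qspanD; exact: cP.
by rewrite (c_eq e 1) // mulr1z subrr; exact: qspan0.
Qed.

End Functional.

(** The integer n is the order of the identity of x.  If it were 0 in k, of
    characteristic q, minimality of n would prevent the identity from being a
    multiple z q, since n / q would then kill it; a functional on B(x, x) / q
    then yields a nonzero map from the tensor product of k and B(x, x). *)
Lemma k_trivial_torsion (k : fieldType) (B : addcat) (x : B) : k_trivial k B ->
  exists2 n : nat, n%:R != 0 :> k & (aid x *+ n : ahom x x) = 0.
Proof.
move=> kB; have [fE tE] := kB x x.
pose e : ahom x x := aid x.
have [m m0 em] := finite_torsion e fE.
have exn : exists n, (0 < n)%N && (e *+ n == 0) by exists m; rewrite m0 em eqxx.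
case: (ex_minnP exn) => n /andP[n0 /eqP en] nmin.
exists n => //; apply/negP => nk.
have [q qk] := natf0_pchar n0 nk.
have qn : (q %| n)%N by rewrite (dvdn_pcharf qk).
have q1 := prime_gt1 (pcharf_prime qk).
have nE (z : ahom x x) : z *+ n = 0.
  have h0 : acomp (0 : ahom x x) z = 0.
    by apply: (@addrI _ (acomp (0 : ahom x x) z)); rewrite -acompDl !addr0.
  have h j : acomp (e *+ j) z = z *+ j.
    by elim: j => [|j IH] //; rewrite !mulrS acompDl IH acomp1c.
  by rewrite -h en h0.
have eNq z : e <> z *+ q.
  move=> ez; have /nmin : (0 < n %/ q)%N && (e *+ (n %/ q) == 0).
    by rewrite divn_gt0 ?prime_gt0 ?(pcharf_prime qk) // dvdn_leq //= ez -mulrnA mulnC divnK // nE.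
  by rewrite leqNgt ltn_Pdiv.
have [phi [phiD phie]] := exists_functional qk eNq.
pose g (ab : k * ahom x x) : zmodule k := ab.1 * phi ab.2.
have gR u : tensZ_rel u -> free_lift g u = 0.
  case=> [a a' b|a b b']; rewrite !linearB !free_liftE /g /=.
    by rewrite mulrDl addrAC addrK subrr.
  by rewrite phiD mulrDr addrAC addrK subrr.
have /quot_eqP := etrans (tE (quot_pi _ << (1, e) >>)) (esym (linear0 (quot_pi _))).
rewrite subr0 => /(span_sub_ker gR); rewrite free_liftE /g /= phie mulr1.
by apply/eqP; rewrite oner_eq0.
Qed.

End Torsion.

(** * The standard resolution of an acyclic functor *)

Section StdRes.
Variables (k : fieldType) (C D : cat) (p : functor C D) (G : kfunctor k C).
Hypothesis aG : forall n, acyclic p n G.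

Lemma acyclic_std m n : acyclic p n (syzygy G m).
Proof.
elim: m n => [|m IH] n; first exact: aG.
exact: (acyclic_syzygy (IH n.+1) (@cover_projective k C _)
  (ses_nat_ker (@cover_aug_surj k C _))).2.
Qed.

(** The boundary of t is the image of t in the next syzygy; purity of the
    syzygy in the cover puts it in J of the syzygy, so that t differs from an
    element of J by a cycle. *)
Lemma std_res_J n x (t : std_res G n.+1 x) :
  res_d (std_res G) n x t \in J_sub p (std_res G n) x ->
  exists r, t - res_d (std_res G) n.+1 x r \in J_sub p (std_res G n.+1) x.
Proof.
move=> tJ.
have [pu _] := acyclic_syzygy (@acyclic_std n 1) (@cover_projective k C _)
  (ses_nat_ker (@cover_aug_surj k C (syzygy G n))).
have aJ := pu x (cover_aug (syzygy G n.+1) x t) tJ.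
have [s sJ sE] := J_lift (@cover_aug_surj k C (syzygy G n.+1)) aJ.
have [r rE] : exists r, std_d G n.+1 x r = t - s.
  by apply/std_exact; rewrite linearB sE subrr.
by exists r; rewrite [res_d _ _ _ _]rE opprB addrC subrK.
Qed.

End StdRes.

Local Open Scope classical_set_scope.

Theorem theorem3 (k : fieldType)
    (k_infinite : infinite_set [set: k]) (k_perfect : perfect_field k)
    (A B : addcat) (p : functor A B)
    (p_full : full p) (p_additive : additive_functor p)
    (p_esurj : essentially_surjective p) (B_trivial : k_trivial k B)
    (F : kfunctor k (opcat B)) (F' G : kfunctor k B) :
  (forall n : nat, bijective
     (Ext_res p F' G n :
        Ext F' G n -> Ext (pull p F') (pull p G) n)) /\
  (forall n : nat, bijective
     (Tor_res p F G n :
        Tor (pull (opfunctor p) F) (pull p G) n -> Tor F G n)).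
Proof.
have tors x := k_trivial_torsion x B_trivial.
have aM n M := @acyclic_pull k A B p p_additive tors n M.
split=> n.
- exact: (Ext_res_of_bij p_full p_esurj (std_lift p F') (std_res_J (aM^~ F'))).
- exact: (Tor_res_of_bij p_full p_esurj (std_lift p G) (std_res_J (aM^~ G))).
Qed.
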